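(* For any fixed variable $4$-line configuration, the number of its occurrences in a Steiner triple system of order $v$ can be computed in time $O(v^3)$.
   Context: A Steiner triple system of order $v$, STS$(v)$, is a pair $(V,\mathcal{B})$ with $|V|=v$ and $\mathcal{B}$ a set of 3-subsets (lines) of $V$ such that every 2-subset of $V$ lies in exactly one line. A configuration in it is a subset $\mathcal{B}'\subseteq\mathcal{B}$ together with the union of its lines as point set; an $n$-line configuration has $n$ lines. The number of occurrences of a configuration $C$ in an STS is the number of subsets $\mathcal{B}'\subseteq\mathcal{B}$ whose configuration is isomorphic to $C$. A configuration is constant if its number of occurrences in an STS$(v)$ depends only on $v$ (the same for all STS$(v)$), and variable otherwise. The STS is the input. *)

(* Defs.v *)
From mathcomp Require Import all_boot.

Set Implicit Arguments.
Unset Strict Implicit.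
Unset Printing Implicit Defensive.

Definition STS (T : finType) (v : nat) (B : {set {set T}}) : Prop :=
  [/\ #|T| = v,
      forall l : {set T}, l \in B -> #|l| = 3
    & forall e : {set T}, #|e| = 2 ->
        exists! l : {set T}, l \in B /\ e \subset l].

(* A configuration is given by its set of lines C; its point set is [cover C].
   An isomorphism is a bijection of point sets that maps the line set onto the
   line set.  It is represented by a function on the whole ambient point set of
   which only the restriction to [cover C] matters: such an extension exists as
   soon as C has a nonempty line. *)
Definition conf_iso (S T : finType) (C : {set {set S}}) (D : {set {set T}}) :
    bool :=
  [exists f : {ffun S -> T},
     dinjectiveb f (mem (cover C)) && (D == [set f @: (l : {set S}) | l in C])].

Definition occurrences (S T : finType) (C : {set {set S}})
    (B : {set {set T}}) : nat :=
  #|[set D : {set {set T}} | (D \subset B) && conf_iso C D]|.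

Definition constant_conf (S : finType) (C : {set {set S}}) : Prop :=
  forall (v : nat) (T1 T2 : finType)
         (B1 : {set {set T1}}) (B2 : {set {set T2}}),
    STS v B1 -> STS v B2 -> occurrences C B1 = occurrences C B2.

Definition variable_conf (S : finType) (C : {set {set S}}) : Prop :=
  ~ constant_conf C.

(* Word RAM: registers [R_i], directly addressed (a program mentions only
   finitely many of them), and a memory M, addressed through registers.  Every
   instruction costs one time unit; the bound on the size of words is imposed
   in [sts_computable_in_time]. *)
Inductive instr : Type :=
| Const (d n : nat)
| Move (d a : nat)
| Add (d a b : nat)
| Sub (d a b : nat)
| Mul (d a b : nat)
| Div (d a b : nat)
| Read (d a : nat)
| Write (a b : nat)
| Jump (p : nat)
| JumpLt (a b p : nat)
| JumpEq (a b p : nat)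
| Halt.

Definition program := seq instr.

Record state : Type :=
  State { pc : nat; regs : nat -> nat; mem_of : nat -> nat }.

Definition upd (f : nat -> nat) (i n : nat) : nat -> nat :=
  fun j => if j == i then n else f j.

(* [None] means that the machine has halted; running past the end of the
   program halts as well. *)
Definition step (P : program) (s : state) : option state :=
  let: State p r m := s in
  let set_reg d n := Some (State p.+1 (upd r d n) m) in
  let goto q := Some (State q r m) in
  match onth P p with
  | None | Some Halt => None
  | Some (Const d n) => set_reg d n
  | Some (Move d a) => set_reg d (r a)
  | Some (Add d a b) => set_reg d (r a + r b)
  | Some (Sub d a b) => set_reg d (r a - r b)
  | Some (Mul d a b) => set_reg d (r a * r b)
  | Some (Div d a b) => set_reg d (r a %/ r b)
  | Some (Read d a) => set_reg d (m (r a))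
  | Some (Write a b) => Some (State p.+1 r (upd m (r a) (r b)))
  | Some (Jump q) => goto q
  | Some (JumpLt a b q) => goto (if r a < r b then q else p.+1)
  | Some (JumpEq a b q) => goto (if r a == r b then q else p.+1)
  end.

Definition run (P : program) (t : nat) (s : state) : state :=
  iter t (fun s' => odflt s' (step P s')) s.

Definition halts_within (P : program) (t : nat) (s : state) : Prop :=
  step P (run P t s) = None.

Definition init_state (inp : seq nat) : state :=
  State 0 (fun=> 0) (fun i => nth 0 inp i).

Definition output (s : state) : nat := regs s 0.

Definition words_below (m : nat) (s : state) : Prop :=
  (forall i, regs s i < m) /\ (forall i, mem_of s i < m).

(* The input word lists v, the number of lines, and then the lines, in any
   order and each as its three points in any order, for an arbitrary labelling
   of the points by 0, ..., v - 1. *)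
Definition encodes (T : finType) (B : {set {set T}}) (inp : seq nat) : Prop :=
  exists (lab : T -> nat) (ts : seq (T * T * T)),
    [/\ injective lab,
        forall x, lab x < #|T|,
        perm_eq [seq [set t.1.1; t.1.2; t.2] | t <- ts] (enum B)
      & inp = #|T| :: size ts ::
              flatten [seq [:: lab t.1.1; lab t.1.2; lab t.2] | t <- ts]].

(* A single program computes F B from any encoding of any Steiner triple system
   B, in time O(g v) where v is the order of B.  All words stay below
   (v + 2) ^ k, i.e. have O(log v) bits, so that unit cost is legitimate. *)
Definition sts_computable_in_time
    (F : forall T : finType, {set {set T}} -> nat) (g : nat -> nat) : Prop :=
  exists (P : program) (c v0 k : nat),
  forall (v : nat) (T : finType) (B : {set {set T}}) (inp : seq nat),
    STS v B -> encodes B inp ->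
    exists t : nat,
      [/\ halts_within P t (init_state inp),
          output (run P t (init_state inp)) = F T B,
          v0 <= v -> t <= c * g v
        & forall i, i <= t -> words_below ((v + 2) ^ k) (run P i (init_state inp))].

(* Main.v *)
Require Import Defs.
From mathcomp Require Import all_boot zify.

(** Write t(x, y) for the third point on the line through x and y.  For a set P
    of points and a set C of at most four triples in P, the number of maps that
    are injective on P and send C into the lines of an STS(v) is an arithmetic
    expression in v and in the number p of Pasch triples, that is of triples of
    non-collinear points with t(t(x, y), t(x, z)) = t(y, z).  This follows by
    induction on #|P|.  A point c on no line can be placed anywhere off the image
    of P \ c.  If c lies on a single line {a, b, c}, then its image must be
    t(f a, f b), and the maps to be excluded are those with t(f a, f b) = f d for
    some d in P \ {a, b, c}; they are counted by the configuration on P \ c in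
    which {a, b, d} replaces {a, b, c}.  If two triples share two points, there is
    no such map.  In the remaining case every point is on two lines, and four
    lines force P to be empty or the Pasch configuration.  The number of
    occurrences of C is the number of embeddings divided by the number of
    automorphisms of C.

    The machine tabulates t, counts the Pasch triples in one loop of length v^3,
    and evaluates the expression. *)

Set Implicit Arguments.
Unset Strict Implicit.
Unset Printing Implicit Defensive.

(** * Third points in a Steiner triple system *)

Definition third (T : finType) (B : {set {set T}}) (x y : T) : T :=
  odflt x [pick z | [set x; y; z] \in B].

Lemma card3_dest (T : finType) (l : {set T}) (c : T) :
  #|l| = 3 -> c \in l ->
  exists a b, [/\ l = [set a; b; c], a != b, a != c & b != c].
Proof.
move=> l3 lc; have /eqP/cards2P[a [b [ab E]]] : #|l :\ c| = 2.
  by move: l3; rewrite (cardsD1 c) lc => -[].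
have : a \in l :\ c by rewrite E set21.
have : b \in l :\ c by rewrite E set22.
rewrite !inE => /andP[bc _] /andP[ac _]; exists a, b; split=> //.
by rewrite -(setD1K lc) E setUC.
Qed.

Lemma card_set3 (T : finType) (x y z : T) :
  #|[set x; y; z]| = 3 -> [/\ x != y, x != z & y != z].
Proof.
rewrite setUC cardsU1 cards2 !inE negb_or.
by rewrite (eq_sym z x) (eq_sym z y); case: (x == y); case: (x == z); case: (y == z).
Qed.

Lemma imset_set3 (S T : finType) (f : S -> T) a b c :
  f @: [set a; b; c] = [set f a; f b; f c].
Proof. by rewrite !imsetU !imset_set1. Qed.

Section Steiner.

Variables (T : finType) (v : nat) (B : {set {set T}}).
Hypothesis hB : STS v B.

Lemma STS_card : #|T| = v. Proof. by case: hB. Qed.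

Lemma line_unique (x y : T) (l1 l2 : {set T}) : x != y -> l1 \in B -> l2 \in B ->
  x \in l1 -> y \in l1 -> x \in l2 -> y \in l2 -> l1 = l2.
Proof.
case: hB => _ _ h xy B1 B2 x1 y1 x2 y2.
have /h[l [_ lu]] : #|[set x; y]| = 2 by rewrite cards2 xy.
by rewrite -(lu l1) ?(lu l2) //; split=> //; rewrite subUset !sub1set ?x1 ?x2.
Qed.

Lemma mem_line (x y z : T) : [set x; y; z] \in B -> [/\ x != y, x != z & y != z].
Proof. by case: hB => _ h _ /h/card_set3. Qed.

(** Two lines through [x] and [y] coincide, so at most one [z] qualifies. One exists: if the line
    through them is [a], [b], [x], then [y] is [a] or [b], and the other point completes the pair.
    Hence [pick] does not fall back on its default here. *)
Lemma thirdE (x y z : T) : x != y -> ([set x; y; z] \in B) = (z == third B x y).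
Proof.
move=> xy; have uniq3 z1 z2 :
    [set x; y; z1] \in B -> [set x; y; z2] \in B -> z1 = z2.
  move=> B1 B2; have E : [set x; y; z1] = [set x; y; z2].
    by apply: (line_unique xy) => //; rewrite !inE eqxx ?orbT.
  have [_ xz yz] := mem_line B1.
  have : z1 \in [set x; y; z2] by rewrite -E !inE eqxx !orbT.
  by rewrite !inE ![z1 == _]eq_sym (negPf xz) (negPf yz) /= => /eqP.
rewrite /third; case: pickP => [z0 B0 | none] /=.
  by apply/idP/eqP => [Bz | ->//]; apply: uniq3.
have [l [[lB /subsetP le] _]] : exists! l : {set T}, l \in B /\ [set x; y] \subset l.
  by case: hB => _ _; apply; rewrite cards2 xy.
have xl : x \in l by rewrite le // set21.
have yl : y \in l by rewrite le // set22.
have l3 : #|l| = 3 by case: hB => _ + _; apply.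
have [a [b [El ab ax bx]]] := card3_dest l3 xl.
have : [set x; y; if a == y then b else a] \in B.
  suff -> : [set x; y; if a == y then b else a] = l by [].
  move: yl; rewrite El !inE [y == x]eq_sym (negPf xy) orbF.
  case: (a =P y) => [-> _|ay /orP[/eqP|/eqP->]]; last 2 first.
  - by move=> ya; case: ay.
  - by apply/setP=> u; rewrite !inE; case: (u == a); case: (u == b); case: (u == x).
  by apply/setP=> u; rewrite !inE; case: (u == y); case: (u == b); case: (u == x).
by rewrite none.
Qed.

Lemma third_line (x y : T) : x != y -> [set x; y; third B x y] \in B.
Proof. by move=> xy; rewrite thirdE. Qed.

Lemma third_neq (x y : T) : x != y -> third B x y != x /\ third B x y != y.
Proof. by move=> /third_line/mem_line[_]; rewrite ![_ == third _ _ _]eq_sym. Qed.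

Lemma thirdC (x y : T) : x != y -> third B x y = third B y x.
Proof.
by move=> xy; apply/eqP; rewrite -thirdE 1?eq_sym // [[set y; x]]setUC third_line.
Qed.

Lemma thirdK (x y : T) : x != y -> third B x (third B x y) = y.
Proof.
move=> xy; apply/esym/eqP; rewrite -thirdE 1?eq_sym ?(third_neq xy).1 //.
by rewrite setUAC third_line.
Qed.

Lemma third_inj (x y z : T) : x != y -> x != z -> third B x y = third B x z -> y = z.
Proof. by move=> xy xz E; rewrite -(thirdK xy) E thirdK. Qed.

(** Every line is the image of an ordered pair of its points. This crude bound already keeps the
    tabulation of third points within cubic time. *)
Lemma card_lines : #|B| <= v ^ 2.
Proof.
rewrite -STS_card -mulnn -card_prod.
apply: leq_trans (leq_imset_card (fun q => [set q.1; q.2; third B q.1 q.2]) _).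
apply/subset_leq_card/subsetP => l lB.
have l3 : #|l| = 3 by case: hB => _ + _; apply.
have /card_gt0P[c lc] : 0 < #|l| by rewrite l3.
have [a [b [El ab _ _]]] := card3_dest l3 lc.
apply/imsetP; exists (a, b) => //=; rewrite El; congr (_ :|: [set _]).
by apply/eqP; rewrite -thirdE // -El.
Qed.

End Steiner.

(** * Counting functions one value at a time *)

Section Update.

Variables S T : finType.
Implicit Types (f : {ffun S -> T}) (A : {set {ffun S -> T}}) (x : S) (y : T).

Definition fupd f x y : {ffun S -> T} := [ffun z => if z == x then y else f z].

Lemma fupdE f x y z : fupd f x y z = if z == x then y else f z.
Proof. by rewrite ffunE. Qed.

Lemma fupd_notin f x y (l : {set S}) : x \notin l -> fupd f x y @: l = f @: l.
Proof.
move=> xl; apply: eq_in_imset => z zl; rewrite fupdE.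
by case: eqP => // E; rewrite -E zl in xl.
Qed.

(** Double counting of pairs [(f, y)]: exchanging [y] with [f x] is an involution that turns
    [fupd f x y \in A] into [f \in A], which leaves [y] free. *)
Lemma card_fupd A x : #|T| * #|A| = \sum_f #|[set y | fupd f x y \in A]|.
Proof.
pose h (q : {ffun S -> T} * T) := (fupd q.1 x q.2, q.1 x).
have hK : involutive h.
  move=> [f y]; rewrite /h /=; congr (_, _); last by rewrite fupdE eqxx.
  by apply/ffunP => z; rewrite !fupdE; case: eqP => [->|].
transitivity (\sum_f \sum_y (fupd f x y \in A : nat)); last first.
  apply: eq_bigr => f _; rewrite -sum1_card [RHS]big_mkcond /=.
  by apply: eq_bigr => y _; rewrite inE; case: (_ \in _).
rewrite pair_big /= (reindex_inj (inv_inj hK)) /=.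
rewrite (eq_bigr (fun q : {ffun S -> T} * T => (q.1 \in A : nat))); last first.
  by move=> q _; have := hK q; rewrite /h /= => /(congr1 fst) /= ->.
rewrite -(pair_big xpredT xpredT (fun f (y : T) => (f \in A : nat))) /=.
rewrite (eq_bigr (fun f => #|T| * (f \in A))); last by move=> f _; rewrite sum_nat_const.
by rewrite -big_distrr /= -(sum1_card (mem A)) big_mkcond.
Qed.

(** In the applications [A0] collects the candidates on the remaining points and [k] counts the
    placements of [x]. The value a candidate itself takes at [x] is arbitrary, whence the factor
    [#|T|]. *)
Lemma card_fupd_const A A0 x k :
  (forall f, #|[set y | fupd f x y \in A]| = (f \in A0) * k) ->
  #|T| * #|A| = #|A0| * k.
Proof.
move=> h; rewrite (card_fupd A x) (eq_bigr _ (fun f _ => h f)) -big_distrl /=.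
by rewrite -(sum1_card (mem A0)) [in RHS]big_mkcond.
Qed.

(** Each prescribed value costs a factor [#|T|]; the product form avoids a division and the exponent
    [#|S| - size s]. *)
Lemma card_ffun_values (s : seq S) (u : seq T) : uniq s -> size u = size s ->
  #|T| ^ size s * #|[set f : {ffun S -> T} | map f s == u]| = #|T| ^ #|S|.
Proof.
elim: s u => [|x s IH] [|y u] //= => [_ _|/andP[xs us] [su]].
  by rewrite expn0 mul1n -card_ffun -cardsT; congr #|pred_of_set _|; apply/setP=> f; rewrite !inE.
rewrite expnSr -mulnA (@card_fupd_const _ [set f : {ffun S -> T} | map f s == u] x 1).
  by rewrite muln1 IH.
move=> f; rewrite inE muln1; have E z : map (fupd f x z) s = map f s.
  by apply/eq_in_map => w ws; rewrite fupdE; case: eqP => // e; rewrite -e ws in xs.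
case: (boolP (map f s == u)) => /= fs.
  rewrite -(cards1 y); congr #|pred_of_set _|; apply/setP=> z.
  by rewrite !inE eqseq_cons E fs fupdE eqxx andbT.
by apply: eq_card0 => z; rewrite !inE eqseq_cons E (negPf fs) andbF.
Qed.

End Update.

(* Values outside P are unconstrained, so removing a point from P costs a factor
   #|T| in the counting identities below. *)
Definition emb (S T : finType) (P : {set S}) (C : {set {set S}}) (B : {set {set T}}) :=
  [set f : {ffun S -> T} | dinjectiveb f (mem P) & [forall l in C, f @: (l : {set S}) \in B]].

(** * Embeddings of a set of triples into the lines of a system *)

Section Embeddings.

Variables S T : finType.
Implicit Types (f : {ffun S -> T}) (P : {set S}) (C : {set {set S}}) (B : {set {set T}}).

Lemma embP P C B f :
  reflect ({in P &, injective f} /\ forall l, l \in C -> f @: l \in B) (f \in emb P C B).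
Proof.
rewrite inE; apply: (iffP andP) => -[h1 h2]; split.
- exact/dinjectiveP.
- by move=> l lC; have /forall_inP := h2; apply.
- exact/dinjectiveP.
- exact/forall_inP.
Qed.

Lemma fupd_injP P f x y : x \in P ->
  {in P &, injective (fupd f x y)} <->
  {in P :\ x &, injective f} /\ y \notin f @: (P :\ x).
Proof.
move=> xP; split=> [fi | [fi yf] u w uP wP].
  split=> [u w /setD1P[ux uP] /setD1P[wx wP] E|].
    by apply: fi => //; rewrite !fupdE (negPf ux) (negPf wx).
  apply/imsetP => -[u /setD1P[ux uP] E]; case/eqP: ux.
  by apply: fi => //; rewrite !fupdE eqxx E; case: eqP => // ->.
have im z : z \in P -> z != x -> f z \in f @: (P :\ x).
  by move=> zP zx; rewrite imset_f // !inE zx.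
rewrite !fupdE; case: eqVneq => [->|ux]; case: eqVneq => [->|wx] // E.
- by rewrite E im in yf.
- by rewrite -E im in yf.
- by apply: fi => //; rewrite !inE ?ux ?wx.
Qed.

(** An admissible value at [x] is any point off the image of [P :\ x], and by injectivity this image
    has [#|P :\ x|] elements. *)
Lemma card_emb_isolated P C B x : x \in P -> (forall l, l \in C -> x \notin l) ->
  #|T| * #|emb P C B| = #|emb (P :\ x) C B| * (#|T| - #|P :\ x|).
Proof.
move=> xP xC; apply: (@card_fupd_const _ _ _ _ x) => f.
have E y : (fupd f x y \in emb P C B) = (f \in emb (P :\ x) C B) && (y \notin f @: (P :\ x)).
  apply/embP/andP => [[/(fupd_injP _ _ xP)[fi yf] fC] | [/embP[fi fC] yf]].
    by split=> //; apply/embP; split=> // l lC; rewrite -(fupd_notin f y (xC l lC)) fC.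
  by split; [apply/fupd_injP | move=> l lC; rewrite fupd_notin ?fC ?xC].
case: (boolP (f \in _)) => [fe|fe]; last first.
  by apply: eq_card0 => y; rewrite [y \in _]inE E (negPf fe).
have -> : [set y | fupd f x y \in emb P C B] = ~: (f @: (P :\ x)).
  by apply/setP => y; rewrite [LHS]inE E fe inE.
have /embP[fi _] := fe.
by rewrite mul1n -(card_in_imset fi) -(cardsC (f @: (P :\ x))) addKn.
Qed.

(** Both lines would go to the unique line through [f x] and [f y], and injectivity on [P] pulls
    this back to [l1 = l2]. *)
Lemma emb_nonlinear P C B v x y (l1 l2 : {set S}) : STS v B ->
  (forall l, l \in C -> l \subset P) ->
  l1 \in C -> l2 \in C -> l1 != l2 -> x != y ->
  x \in l1 -> y \in l1 -> x \in l2 -> y \in l2 -> #|emb P C B| = 0.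
Proof.
move=> hB CP C1 C2 l12 xy x1 y1 x2 y2; apply: eq_card0 => f; apply/negP => /embP[fi fC].
have E : f @: l1 = f @: l2.
  apply: (line_unique hB (x := f x) (y := f y)); rewrite ?fC ?imset_f //.
  by apply: contra_neq xy; apply: fi; exact: (subsetP (CP l1 C1)).
case/eqP: l12.
suff sub (l l' : {set S}) : l \in C -> l' \in C -> f @: l = f @: l' -> l \subset l'.
  by apply/eqP; rewrite eqEsubset !sub.
move=> lC l'C El; apply/subsetP => z zl.
have : f z \in f @: l' by rewrite -El imset_f.
case/imsetP => z' zl' /fi -> //; first exact: (subsetP (CP l lC)).
exact: (subsetP (CP l' l'C)).
Qed.

(** Since the image of [c] is forced, it remains to discard the maps whose forced point is already
    the image of some [d]. Injectivity allows at most one such [d] per map, so no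
    inclusion-exclusion arises. The points [a] and [b] cannot be such a [d], as a third point
    differs from the two points it comes from. *)
Lemma card_emb_pendant P C B v a b c : STS v B ->
  a != b -> a != c -> b != c -> [set a; b; c] \in C -> [set a; b; c] \subset P ->
  (forall l, l \in C -> c \in l -> l = [set a; b; c]) ->
  #|T| * #|emb P C B| = #|emb (P :\ c) (C :\ [set a; b; c]) B| -
    \sum_(d in P :\: [set a; b; c])
      #|emb (P :\ c) ([set a; b; d] |: (C :\ [set a; b; c])) B|.
Proof.
move=> hB ab ac bc lC lP cC; set l := [set a; b; c].
set X := emb _ (C :\ l) B; pose Xd d := emb (P :\ c) ([set a; b; d] |: (C :\ l)) B.
have aP : a \in P by apply: (subsetP lP); rewrite !inE eqxx.
have bP : b \in P by apply: (subsetP lP); rewrite !inE eqxx !orbT.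
have cP : c \in P by apply: (subsetP lP); rewrite !inE eqxx !orbT.
have fab f : f \in X -> f a != f b.
  case/embP => fi _; apply: contra_neq ab; apply: fi; rewrite !inE ?ac ?bc //.
have XdE f d : (f \in Xd d) = (f \in X) && (f d == third B (f a) (f b)).
  apply/embP/andP => [[fi fC] | [fX fd]].
    have fX : f \in X.
      by apply/embP; split=> // l' Cl'; rewrite fC // setU1r.
    by split=> //; rewrite -(thirdE hB) ?fab // -imset_set3 fC // setU11.
  have /embP[fi fC] := fX; split=> // l' /setU1P[->|/fC//].
  by rewrite imset_set3 (thirdE hB) ?fab.
(* [A0] holds the maps on [P :\ c] whose forced point is still free; each has exactly one admissible
   value at [c]. *)
pose A0 := [set f in X | [forall d in P :\: l, f \notin Xd d]].
have -> : #|T| * #|emb P C B| = #|A0| * 1.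
  apply: (@card_fupd_const _ _ _ _ c) => f; rewrite muln1.
  have E y : (fupd f c y \in emb P C B) =
      [&& f \in X, y \notin f @: (P :\ c) & y == third B (f a) (f b)].
    have El : fupd f c y @: l = [set f a; f b; y].
      by rewrite imset_set3 !fupdE (negPf ac) (negPf bc) eqxx.
    apply/embP/and3P => [[/(fupd_injP _ _ cP)[fi yf] fC] | [fX yf yt]].
      have fX : f \in X.
        apply/embP; split=> // l' /setD1P[l'l l'C].
        rewrite -(fupd_notin f y (x := c)) ?fC //.
        by apply: contra_neqN l'l; exact: cC.
      by split=> //; rewrite -(thirdE hB) ?fab // -El fC.
    have /embP[fi fC] := fX; split; first exact/fupd_injP.
    move=> l' l'C; have [->|l'l] := eqVneq l' l; first by rewrite El (thirdE hB) ?fab.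
    rewrite fupd_notin ?fC ?inE ?l'l //.
    by apply: contra_neqN l'l; exact: cC.
  case: (boolP (f \in A0)) => [|fA].
    rewrite inE => /andP[fX /forall_inP fd].
    rewrite /= -(cards1 (third B (f a) (f b))); congr #|pred_of_set _|.
    apply/setP => y; rewrite [LHS]inE E fX inE /=; case: eqP => [->|//]; rewrite ?andbF // andbT.
    apply/imsetP => -[d /setD1P[dc dP] fdE].
    have [na nb] := third_neq hB (fab _ fX).
    have dl : d \in P :\: l.
      rewrite !inE dP (negPf dc) !orbF andbT negb_or.
      rewrite fdE in na nb; apply/andP; split; first by apply: contra_neq na => ->.
      by apply: contra_neq nb => ->.
    by move: (fd d dl); rewrite XdE fX fdE eqxx.
  apply: eq_card0 => y; rewrite [y \in _]inE E; apply: contraNF fA => /and3P[fX yf /eqP yt].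
  rewrite inE fX; apply/forall_inP => d /setDP[dP dl]; rewrite XdE fX /= -yt.
  apply: contra yf => /eqP <-; rewrite imset_f // !inE dP andbT.
  by apply: contraNneq dl => ->; rewrite !inE eqxx orbT.
(* [X] is the disjoint union of [A0] and the sets [Xd d], so the subtraction does not truncate. *)
rewrite muln1; suff -> : #|X| = #|A0| + \sum_(d in P :\: l) #|Xd d| by rewrite addnK.
rewrite -!sum1_card [LHS]big_mkcond [in RHS]big_mkcond /=.
rewrite (eq_bigr (fun d => \sum_f (f \in Xd d : nat))); last first.
  by move=> d _; rewrite -(sum1_card (mem (Xd d))) big_mkcond.
rewrite exchange_big -big_split /=; apply: eq_bigr => f _; rewrite [f \in A0]inE.
case: (boolP (f \in X)) => [fX|fX] /=; last first.
  by rewrite big1 // => d _; rewrite XdE (negPf fX).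
case: (boolP [forall _ in _, _]) => [/forall_inP fd | /forall_inPn[d dl /negPn fd]].
  by rewrite big1 // => d dl; rewrite (negPf (fd d dl)).
rewrite (bigD1 d) //= fd big1 // => d' /andP[d'l d'd].
apply/eqP; rewrite eqb0; apply: contra d'd; move: fd; rewrite !XdE fX /= => /eqP <-.
have /embP[fi _] := fX; move=> /eqP/fi -> //.
- by move: d'l; rewrite !inE !negb_or => /andP[/andP[_ ->] ->].
- by move: dl; rewrite !inE !negb_or => /andP[/andP[_ ->] ->].
Qed.

End Embeddings.

(** * Pasch triples and the Pasch configuration *)

Definition pasch_triple (T : finType) (B : {set {set T}}) (x y z : T) : bool :=
  [&& x != y, x != z, y != z, third B x y != z
    & third B (third B x y) (third B x z) == third B y z].

Definition pasch (T : finType) (B : {set {set T}}) : nat :=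
  #|[set q : T * T * T | pasch_triple B q.1.1 q.1.2 q.2]|.

(** Two of the third points share a vertex, so if they agreed, [third_inj] would identify two of
    [x], [y], [z]. If one of them were the remaining vertex, the three points would be collinear. *)
Lemma pasch_triple_uniq (T : finType) v (B : {set {set T}}) x y z : STS v B ->
  pasch_triple B x y z ->
  uniq [:: x; y; z; third B x y; third B x z; third B y z].
Proof.
move=> hB /and5P[xy xz yz wz _].
have [wx wy] := third_neq hB xy; have [ux uz] := third_neq hB xz.
have [qy qz] := third_neq hB yz.
have uy : third B x z != y by apply: contra_neq wz => <-; rewrite (thirdK hB).
have qx : third B y z != x.
  by apply: contra_neq wz => <-; rewrite -(thirdC hB) ?(thirdK hB) // eq_sym.
have wu : third B x y != third B x z by apply: contra_neq yz; apply: (third_inj hB).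
have wq : third B x y != third B y z.
  rewrite (thirdC hB) //; apply: contra_neq xz; apply: (third_inj hB) => //.
  by rewrite eq_sym.
have uq : third B x z != third B y z.
  rewrite (thirdC hB) // (thirdC hB yz); apply: contra_neq xy.
  by apply: (third_inj hB); rewrite eq_sym.
rewrite /= !inE !negb_or.
by rewrite xy xz yz wu wq uq ![_ == third _ _ _]eq_sym wx wy wz ux uy uz qx qy qz.
Qed.

Lemma pasch_leq (T : finType) v (B : {set {set T}}) : STS v B -> pasch B <= v ^ 3.
Proof.
move=> hB; rewrite -(STS_card hB); apply: leq_trans (max_card _) _.
by rewrite !card_prod !expnS expn0 muln1 mulnA.
Qed.

Lemma card3_dest2 (T : finType) (l : {set T}) (x y : T) :
  #|l| = 3 -> x != y -> x \in l -> y \in l ->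
  exists z, [/\ l = [set x; y; z], x != z & y != z].
Proof.
move=> l3 xy xl yl; have [a [b [E ab ay by']]] := card3_dest l3 yl.
move: xl; rewrite E !inE (negPf xy) orbF => /orP[]/eqP e; subst x.
  by exists b; split=> //; rewrite 1?eq_sym //; rewrite setUAC.
exists a; rewrite ![_ == a]eq_sym; split=> //.
by rewrite [[set a; b]]setUC setUAC.
Qed.

(** Take a line [l1] through [a], a second line [l2] through [a], and second lines [l3], [l4]
    through the other points [b], [c] of [l1]. Linearity makes them distinct, so they exhaust [C].
    The two further points of [l2] need second lines, which must be [l3] and [l4], and the last
    point of [l3] must then lie on [l4]. *)
Lemma pasch_structure (S : finType) (P : {set S}) (C : {set {set S}}) :
  #|C| <= 4 -> (forall l, l \in C -> l \subset P /\ #|l| = 3) ->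
  (forall x y (l l' : {set S}), x != y -> l \in C -> l' \in C ->
     x \in l -> y \in l -> x \in l' -> y \in l' -> l = l') ->
  (forall x, x \in P -> exists2 l, l \in C & x \in l) ->
  (forall x l, l \in C -> x \in l -> exists l', [/\ l' \in C, l' != l & x \in l']) ->
  P != set0 ->
  exists a b c d e g, [/\ uniq [:: a; b; d; c; e; g], P =i [:: a; b; d; c; e; g]
    & C = [set [set a; b; c]; [set a; d; e]; [set b; d; g]; [set c; e; g]]].
Proof.
move=> C4 CP lin cov deg2 /set0Pn[a aP].
have [l1 C1 a1] := cov a aP; have [l2 [C2 l21 a2]] := deg2 a l1 C1 a1.
have [b [c [E1 bc ba ca]]] := card3_dest (CP l1 C1).2 a1.
have b1 : b \in l1 by rewrite E1 !inE eqxx.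
have c1 : c \in l1 by rewrite E1 !inE eqxx orbT.
have not2 x : x \in l1 -> x != a -> x \notin l2.
  by move=> x1 xa; apply: contra_neqN l21 => x2; apply: (lin x a).
have b2 := not2 b b1 ba; have c2 := not2 c c1 ca.
have [l3 [C3 l31 b3]] := deg2 b l1 C1 b1; have [l4 [C4' l41 c4]] := deg2 c l1 C1 c1.
have l32 : l3 != l2 by apply: contraNneq b2 => <-.
have l42 : l4 != l2 by apply: contraNneq c2 => <-.
have c3 : c \notin l3 by apply: contra_neqN l31 => c3; apply: (lin b c).
have l43 : l4 != l3 by apply: contraNneq c3 => <-.
have EC : C = [set l1; l2; l3; l4].
  apply/esym/eqP; rewrite eqEcard !subUset !sub1set C1 C2 C3 C4' /=.
  apply: leq_trans C4 _; rewrite setUC cardsU1 setUC cardsU1 cards2 !inE.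
  by rewrite (eq_sym l1) l21 (negPf l31) (negPf l32) (negPf l41) (negPf l42) (negPf l43).
have inC l x : l \in C -> x \in l -> [|| x \in l1, x \in l2, x \in l3 | x \in l4].
  by rewrite EC !inE -!orbA => /or4P[]/eqP-> ->; rewrite ?orbT.
have on34 x : x \in l2 -> x != a -> x \notin l1 /\ ((x \in l3) || (x \in l4)).
  move=> x2 xa; have x1 : x \notin l1 by apply: contraL x2 => x1; apply: not2.
  split=> //; have [l' [C' n2 x']] := deg2 x l2 C2 x2.
  move: C' n2; rewrite EC !inE -!orbA => /or4P[]/eqP E; subst l'; rewrite ?eqxx //.
  - by rewrite x' in x1.
  - by rewrite x'.
  - by rewrite x' orbT.
(* Neither [l3] nor [l4] can contain both further points of [l2]; they are named so that [d] lies on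
   [l3] and [e] on [l4]. *)
have [d [e [[E2 de da ea] [d3 e4]]]] : exists d e,
    [/\ l2 = [set d; e; a], d != e, d != a & e != a] /\ (d \in l3) /\ (e \in l4).
  have [d [e [E2 de da ea]]] := card3_dest (CP l2 C2).2 a2.
  have d2 : d \in l2 by rewrite E2 !inE eqxx.
  have e2 : e \in l2 by rewrite E2 !inE eqxx orbT.
  have once l : l \in C -> l != l2 -> d \in l -> e \in l -> False.
    by move=> lC /eqP ll2 dl el; apply: ll2; apply: (lin d e).
  have [_ /orP[d3|d4]] := on34 d d2 da; have [_ /orP[e3|e4]] := on34 e e2 ea.
  - by case: (once l3).
  - by exists d, e.
  - exists e, d; split=> //; split=> //; last by rewrite eq_sym.
    by rewrite E2 [[set e; d]]setUC.
  - by case: (once l4).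
have d2 : d \in l2 by rewrite E2 !inE eqxx.
have e2 : e \in l2 by rewrite E2 !inE eqxx orbT.
have bd : b != d by apply: contraNneq b2 => ->.
have be : b != e by apply: contraNneq b2 => ->.
have cd : c != d by apply: contraNneq c2 => ->.
have ce : c != e by apply: contraNneq c2 => ->.
have [g [E3 bg dg]] := card3_dest2 (CP l3 C3).2 bd b3 d3.
have g3 : g \in l3 by rewrite E3 !inE eqxx orbT.
have g1 : g \notin l1 by apply: contra_neqN l31 => g1; apply: (lin b g).
have g2 : g \notin l2 by apply: contra_neqN l32 => g2; apply: (lin d g).
have ag : a != g by apply: contraNneq g1 => <-.
have cg : c != g by apply: contraNneq g1 => <-.
have eg : e != g by apply: contraNneq g2 => <-.
have g4 : g \in l4.
  have [l' [C' n3 g']] := deg2 g l3 C3 g3.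
  move: C' n3; rewrite EC !inE -!orbA => /or4P[]/eqP E; subst l'; rewrite ?eqxx //.
  - by rewrite g' in g1.
  - by rewrite g' in g2.
have E4 : l4 = [set c; e; g].
  apply/esym/eqP; rewrite eqEcard !subUset !sub1set c4 e4 g4 (CP l4 C4').2 /=.
  by rewrite setUC cardsU1 cards2 ce !inE ![g == _]eq_sym (negPf cg) (negPf eg).
exists a, b, c, d, e, g; split.
- rewrite /= !inE !negb_or ![a == _]eq_sym ba da ca ea [g == a]eq_sym ag.
  by rewrite bd bc be bg ![d == c]eq_sym cd de dg ce cg eg.
- move=> x; apply/idP/idP => [/cov[l lC xl]|].
    move: (inC l x lC xl); rewrite E1 E2 E3 E4 !inE.
    by case: (x == a); case: (x == b); case: (x == c); case: (x == d);
       case: (x == e); case: (x == g).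
  have sub l y : l \in C -> y \in l -> y \in P.
    by move=> /CP[/subsetP + _]; apply.
  rewrite !inE => /or4P[/eqP->|/eqP->|/eqP->|/or3P[]/eqP->] //.
  + exact: (sub l1).
  + exact: (sub l2).
  + exact: (sub l1).
  + exact: (sub l2).
  + exact: (sub l3).
- rewrite EC E1 E2 E3 E4; congr (_ :|: _ :|: _ :|: _); congr [set _].
  + by rewrite setUC setUA.
  + by rewrite setUC setUA.
Qed.

(** The list starts with [a], [b], [d] because their images determine those of [c], [e], [g] as
    third points; the fourth line then becomes the last condition of [pasch_triple]. Over each Pasch
    triple of values lie the functions with six prescribed values. *)
Lemma card_emb_pasch (S T : finType) (P : {set S}) (C : {set {set S}}) v (B : {set {set T}})
    (a b c d e g : S) : STS v B ->
  uniq [:: a; b; d; c; e; g] -> P =i [:: a; b; d; c; e; g] ->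
  C = [set [set a; b; c]; [set a; d; e]; [set b; d; g]; [set c; e; g]] ->
  #|T| ^ 6 * #|emb P C B| = pasch B * #|T| ^ #|S|.
Proof.
move=> hB us EP EC; pose s := [:: a; b; d; c; e; g].
pose u (q : T * T * T) := [:: q.1.1; q.1.2; q.2; third B q.1.1 q.1.2;
  third B q.1.1 q.2; third B q.1.2 q.2].
pose val3 (f : {ffun S -> T}) := (f a, f b, f d).
have inj_uniq (f : {ffun S -> T}) : dinjectiveb f (mem P) = uniq (map f s).
  rewrite /dinjectiveb; apply/perm_uniq/perm_map/uniq_perm; rewrite ?enum_uniq //.
  by move=> x; rewrite mem_enum EP.
have embE (f : {ffun S -> T}) : (f \in emb P C B) =
    pasch_triple B (f a) (f b) (f d) && (map f s == u (val3 f)).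
  apply/idP/andP => [fe|[pt /eqP fs]].
    have /embP[fi fC] := fe; move: fe; rewrite inE inj_uniq => /andP[us' _].
    have fC' l : l \in [:: [set a; b; c]; [set a; d; e]; [set b; d; g]; [set c; e; g]] ->
        f @: l \in B.
      by move=> lC; apply: fC; rewrite EC; move: lC; rewrite !inE -!orbA.
    move: us'; rewrite /= !inE !negb_or -!andbA.
    case/and5P=> ab ad ac ae /and5P[ag bd bc be /and5P[bg dc de dg /and4P[ce cg eg _]]].
    have := fC' [set a; b; c]; rewrite !inE eqxx /= imset_set3 (thirdE hB) // => /(_ isT)/eqP Ec.
    have := fC' [set a; d; e]; rewrite !inE eqxx orbT /= imset_set3 (thirdE hB) // => /(_ isT)/eqP Ee.
    have := fC' [set b; d; g]; rewrite !inE eqxx !orbT /= imset_set3 (thirdE hB) // => /(_ isT)/eqP Eg.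
    have := fC' [set c; e; g]; rewrite !inE eqxx !orbT /= imset_set3 (thirdE hB) // => /(_ isT)/eqP E4.
    split; last by rewrite /u /= Ec Ee Eg.
    by rewrite /pasch_triple ab ad bd -Ec [f c == _]eq_sym dc -Ee -Eg E4 eqxx.
  have ut := pasch_triple_uniq hB pt.
  rewrite inE inj_uniq fs {1}/u ut /=; apply/forall_inP => l.
  have /and5P[xy xz yz wz t4] := pt.
  case: fs => Ec Ee Eg.
  rewrite EC !inE -!orbA => /or4P[]/eqP->; rewrite imset_set3 (thirdE hB) ?Ec ?Ee ?Eg //.
    by rewrite eq_sym.
  by move: ut; rewrite /= !inE !negb_or -!andbA => /and5P[_ _ _ _ /and5P[_ _ _ _ /and5P[_ _ _ _ /and3P[]]]].
rewrite -sum1_card (partition_big val3 (fun q => pasch_triple B q.1.1 q.1.2 q.2)) /=; last first.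
  by move=> f; rewrite embE => /andP[].
rewrite big_distrr /= /pasch -[X in _ = X * _]sum1_card big_distrl /= big_mkcond [RHS]big_mkcond /=.
apply: eq_bigr => -[[x y] z] _ /=; rewrite inE /=; case: ifP => // pt.
rewrite mul1n sum1_card -(card_ffun_values us (u := u (x, y, z))) //; congr (_ * _).
apply: eq_card => f; rewrite -topredE /= embE inE /val3.
apply/andP/eqP => [[/andP[_ /eqP E] /eqP[<- <- <-]] | E]; first exact: E.
have [Ea Eb Ed _ _ _] := E; rewrite Ea Eb Ed pt eqxx; split=> //=.
exact/eqP.
Qed.

(** * Arithmetic expressions in the order and the number of Pasch triples *)

Inductive binop : Type := Plus | Minus | Times | Quot.

(** The operations are those of the machine: subtraction truncates at 0 and division rounds down. *)
Inductive aexp : Type :=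
| Lit (n : nat)
| Order
| Pasch
| Bin (o : binop) (e1 e2 : aexp).

Definition binop_eval (o : binop) : nat -> nat -> nat :=
  match o with Plus => addn | Minus => subn | Times => muln | Quot => divn end.

Fixpoint aeval (e : aexp) (v p : nat) : nat :=
  match e with
  | Lit n => n
  | Order => v
  | Pasch => p
  | Bin o e1 e2 => binop_eval o (aeval e1 v p) (aeval e2 v p)
  end.

Definition expressible (F : forall T : finType, {set {set T}} -> nat) : Prop :=
  exists e, forall (T : finType) (v : nat) (B : {set {set T}}),
    STS v B -> F T B = aeval e v (pasch B).

Lemma expressible_sum (I : Type) (r : seq I)
    (F : I -> forall T : finType, {set {set T}} -> nat) (Q : pred I) :
  (forall i, Q i -> expressible (F i)) ->
  expressible (fun T B => \sum_(i <- r | Q i) F i T B).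
Proof.
move=> h; elim: r => [|i r [er Er]].
  by exists (Lit 0) => T v B _; rewrite big_nil.
case Qi : (Q i); last by exists er => T v B hB; rewrite big_cons Qi (Er _ v).
have [ei Ei] := h i Qi; exists (Bin Plus ei er) => T v B hB.
by rewrite big_cons Qi /= -Ei // -Er.
Qed.

Fixpoint order_pow (k : nat) : aexp :=
  if k is k'.+1 then Bin Times Order (order_pow k') else Lit 1.

Lemma aeval_order_pow k v p : aeval (order_pow k) v p = v ^ k.
Proof. by elim: k => //= k ->; rewrite expnS. Qed.

(** The point [x] settles the case of an empty [T]: no function exists then, and both sides are
    0. *)
Lemma card_ffun_set_div (S T : finType) (x : S) (A : {set {ffun S -> T}}) k m :
  #|T| ^ k * #|A| = m -> #|A| = m %/ #|T| ^ k.
Proof.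
move=> <-; have [T0|T0] := posnP #|T|; last by rewrite mulKn // expn_gt0 T0.
suff -> : #|A| = 0 by rewrite muln0 div0n.
apply: eq_card0 => f; have := fintype0 (f x) T0; by [].
Qed.

Lemma emb_expressible (S : finType) (P : {set S}) (C : {set {set S}}) :
  #|C| <= 4 -> (forall l, l \in C -> l \subset P /\ #|l| = 3) ->
  expressible (fun T B => #|emb P C B|).
Proof.
have [n] := ubnP #|P|; elim: n => // n IH in P C *; rewrite ltnS => Pn C4 CP.
case: (boolP [exists l1 in C, exists l2 in C, exists x in l1, exists y in l1,
    [&& l1 != l2, x != y, x \in l2 & y \in l2]]) => [|lin].
  case/exists_inP => l1 C1 /exists_inP[l2 C2 /exists_inP[x x1 /exists_inP[y y1]]].
  case/and4P => l12 xy x2 y2; exists (Lit 0) => T v B hB /=.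
  by apply: (emb_nonlinear hB _ C1 C2 l12 xy) => // l /CP[].
have smaller x : x \in P -> #|P :\ x| < n.
  by move=> xP; apply: leq_trans Pn; rewrite [X in _ < X](cardsD1 x) xP.
case: (boolP [exists x in P, [forall l in C, x \notin l]]) => [|cov].
  case/exists_inP => x xP /forall_inP xC.
  have [|e E] := IH (P :\ x) C (smaller x xP) C4.
    move=> l lC; have [lP l3] := CP l lC; split=> //; apply/subsetP => z zl.
    by rewrite !inE (subsetP lP) // andbT; apply: contraNneq (xC l lC) => <-.
  exists (Bin Quot (Bin Times e (Bin Minus Order (Lit #|P :\ x|))) Order) => T v B hB /=.
  rewrite -E // -(STS_card hB) -[X in _ %/ X]expn1.
  by apply: (card_ffun_set_div x); rewrite expn1; apply: card_emb_isolated.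
case: (boolP [exists c in P, exists l in C, (c \in l) &&
    [forall l' in C, (c \in l') ==> (l' == l)]]) => [|deg2].
  case/exists_inP => c cP /exists_inP[l lC /andP[cl /forall_inP cC]].
  have [lP l3] := CP l lC; have [a [b [El ab ac bc]]] := card3_dest l3 cl.
  have C'P l' : l' \in C :\ l -> l' \subset P :\ c /\ #|l'| = 3.
    case/setD1P => l'l l'C; have [l'P l'3] := CP l' l'C; split=> //.
    apply/subsetP => z zl'; rewrite !inE (subsetP l'P) // andbT.
    by apply: contraNneq l'l => zc; move: (cC l' l'C); rewrite -zc zl'.
  have C'4 : #|C :\ l| <= 3 by move: C4; rewrite (cardsD1 l) lC.
  have [|e E] := IH (P :\ c) (C :\ l) (smaller c cP) _ C'P; first exact: leqW.
  (* The correction terms have one point fewer, and trading [l] for another triple keeps the number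
     of triples within four. *)
  have [|es Es] := @expressible_sum _ (index_enum S)
      (fun d T B => #|emb (P :\ c) ([set a; b; d] |: (C :\ l)) B|) (mem (P :\: l)).
    move=> d; rewrite inE => /setDP[dP dl]; apply: IH (smaller c cP) _ _.
      by rewrite cardsU1; case: (_ \notin _) => //; exact: leqW.
    move=> l' /setU1P[->|]; last exact: C'P.
    move: dl lP; rewrite El !inE !negb_or !subUset !sub1set -!andbA.
    case/and3P => da db dc /and3P[aP bP _]; rewrite !inE aP bP dP ac bc dc.
    by rewrite setUC cardsU1 cards2 ab !inE negb_or da db.
  exists (Bin Quot (Bin Minus e es) Order) => T v B hB /=.
  rewrite -E // -Es // -(STS_card hB) -[X in _ %/ X]expn1.
  apply: (card_ffun_set_div c); rewrite expn1 El; apply: (card_emb_pendant hB) => //.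
  - by rewrite -El.
  - by rewrite -El.
  - by move=> l' l'C cl'; rewrite -El; apply/eqP; move: (cC l' l'C); rewrite cl'.
(* From here on [C] is linear and every point of [P] lies on at least two of its lines. *)
have [P0|Pn0] := eqVneq P set0.
  (* No triple fits into the empty set, so [C] is empty and all functions on [S] count. *)
  exists (order_pow #|S|) => T v B hB; rewrite aeval_order_pow -(STS_card hB) -card_ffun.
  apply: eq_card => f; rewrite !inE; apply/andP; split.
    by apply/dinjectiveP => x; rewrite P0 inE.
  apply/forall_inP => l lC; have [] := CP l lC.
  by rewrite P0 subset0 => /eqP ->; rewrite cards0.
have [a [b [c [d [e [g [us EP EC]]]]]]] : exists a b c d e g,
    [/\ uniq [:: a; b; d; c; e; g], P =i [:: a; b; d; c; e; g]
      & C = [set [set a; b; c]; [set a; d; e]; [set b; d; g]; [set c; e; g]]].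
  apply: pasch_structure => //.
  - move=> x y l l' xy lC l'C xl yl xl' yl'; apply: contraNeq lin => ll'.
    apply/exists_inP; exists l => //; apply/exists_inP; exists l' => //.
    apply/exists_inP; exists x => //; apply/exists_inP; exists y => //.
    by rewrite ll' xy xl' yl'.
  - move=> x xP; move: cov; rewrite negb_exists_in => /forall_inP/(_ x xP).
    by rewrite negb_forall_in => /exists_inP[l lC /negPn xl]; exists l.
  - move=> x l lC xl; have xP : x \in P by have [/subsetP->] := CP l lC.
    move: deg2; rewrite negb_exists_in => /forall_inP/(_ x xP).
    rewrite negb_exists_in => /forall_inP/(_ l lC); rewrite xl /= negb_forall_in.
    by case/exists_inP => l' l'C; rewrite negb_imply => /andP[xl' l'l]; exists l'.
exists (Bin Quot (Bin Times Pasch (order_pow #|S|)) (order_pow 6)) => T v B hB.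
rewrite [RHS]/aeval -/aeval /binop_eval !aeval_order_pow -(STS_card hB); apply: (card_ffun_set_div a).
exact: (card_emb_pasch hB us EP EC).
Qed.

(** * Occurrences as embeddings modulo automorphisms *)

Definition conf_image (S T : finType) (f : S -> T) (C : {set {set S}}) : {set {set T}} :=
  [set f @: (l : {set S}) | l in C].

Lemma conf_image_comp (S T U : finType) (f : S -> T) (g : T -> U) (C : {set {set S}}) :
  conf_image g (conf_image f C) = conf_image (g \o f) C.
Proof.
rewrite /conf_image -imset_comp; apply: eq_imset => l /=.
by rewrite -imset_comp.
Qed.

Lemma eq_conf_image (S T : finType) (f g : S -> T) (C : {set {set S}}) :
  f =1 g -> conf_image f C = conf_image g C.
Proof. by move=> fg; apply: eq_imset => l; apply: eq_imset. Qed.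

Lemma conf_isoP (S T : finType) (C : {set {set S}}) (D : {set {set T}}) :
  reflect (exists2 f : {ffun S -> T}, {in cover C &, injective f} & D = conf_image f C)
          (conf_iso C D).
Proof.
apply: (iffP existsP) => [[f /andP[/dinjectiveP fi /eqP E]] | [f fi E]]; exists f => //.
by rewrite E eqxx andbT; apply/dinjectiveP.
Qed.

Lemma conf_iso_trans (S T U : finType) (C : {set {set S}}) (D : {set {set T}})
    (E : {set {set U}}) : conf_iso C D -> conf_iso D E -> conf_iso C E.
Proof.
case/conf_isoP => f fi -> /conf_isoP[g gi ->]; apply/conf_isoP.
have fC x : x \in cover C -> f x \in cover (conf_image f C).
  case/bigcupP => l lC xl; apply/bigcupP; exists (f @: l); exact: imset_f.
exists [ffun x => g (f x)].
  move=> x y xC yC; rewrite !ffunE => /gi xy; apply: fi => //.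
  by apply: xy; exact: fC.
by rewrite conf_image_comp; apply: eq_conf_image => x; rewrite ffunE.
Qed.

Lemma occurrences_iso (S S' T : finType) (C : {set {set S}}) (C' : {set {set S'}})
    (B : {set {set T}}) :
  conf_iso C C' -> conf_iso C' C -> occurrences C B = occurrences C' B.
Proof.
move=> CC' C'C; apply: eq_card => D; rewrite !inE; congr (_ && _).
by apply/idP/idP; apply: conf_iso_trans.
Qed.

(** Passing to the subtype of covered points makes embeddings injective on the whole type and
    automorphisms permutations of it. The point [x0] is the default value that makes the map from
    [S] to the subtype total. *)
Lemma spanning_copy (S : finType) (C : {set {set S}}) (x0 : S) : x0 \in cover C ->
  exists (S' : finType) (C' : {set {set S'}}),
    [/\ conf_iso C C', conf_iso C' C, cover C' = setT, #|C'| <= #|C|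
      & forall k, (forall l, l \in C -> #|l| = k) -> forall l, l \in C' -> #|l| = k].
Proof.
move=> x0C; pose S' : finType := {x : S | x \in cover C}.
pose u0 : S' := exist _ x0 x0C.
have valK (l : {set S}) : l \in C -> val @: ((val : S' -> S) @^-1: l) = l.
  move=> lC; apply/setP => x; apply/imsetP/idP => [[u]|xl]; first by rewrite inE => ul ->.
  have xC : x \in cover C by apply/bigcupP; exists l.
  by exists (exist _ x xC); rewrite ?inE.
exists S', [set (val : S' -> S) @^-1: (l : {set S}) | l in C]; split.
- apply/conf_isoP; exists [ffun x => insubd u0 x].
    move=> x y xC yC; rewrite !ffunE => /(congr1 val).
    by rewrite !val_insubd xC yC.
  apply: eq_in_imset => l lC; apply/setP => u; rewrite inE.
  apply/idP/imsetP => [ul|[x xl ->]].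
    by exists (val u) => //; rewrite ffunE valKd.
  by rewrite ffunE val_insubd; case: ifP => // /negP[]; apply/bigcupP; exists l.
- apply/conf_isoP; exists [ffun u => val u].
    by move=> u w _ _; rewrite !ffunE => /val_inj.
  rewrite /conf_image -imset_comp -[LHS]imset_id; apply: eq_in_imset => l lC /=.
  by rewrite -[LHS]valK //; apply: eq_imset => u; rewrite ffunE.
- apply/setP => -[x xC]; rewrite inE; case/bigcupP: (xC) => l lC xl.
  by apply/bigcupP; exists (val @^-1: l); rewrite ?inE ?imset_f.
- exact: leq_imset_card.
- move=> k Ck _ /imsetP[l lC ->]; rewrite -(Ck l lC) -[in RHS](valK l lC).
  by rewrite card_imset //; exact: val_inj.
Qed.

(** Embeddings are grouped by their image [D]. Once one embedding [f0] onto [D] is fixed, the others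
    are the maps [f0 \o s] with [s] an automorphism of [C]. *)
Lemma card_emb_occurrences (S T : finType) (C : {set {set S}}) (B : {set {set T}}) :
  cover C = setT ->
  #|emb setT C B| =
    occurrences C B * #|[set s : {ffun S -> S} | injectiveb s & conf_image s C == C]|.
Proof.
move=> CT; set G := [set _ | _ & _].
rewrite -sum1_card (partition_big (fun f : {ffun S -> T} => conf_image f C)
  (mem [set D : {set {set T}} | (D \subset B) && conf_iso C D])) /=; last first.
  move=> f /embP[fi fC]; rewrite inE; apply/andP; split.
    by apply/subsetP => _ /imsetP[l lC ->]; exact: fC.
  by apply/conf_isoP; exists f => //; rewrite CT.
rewrite /occurrences -sum_nat_const; apply: eq_bigr => D; rewrite inE => /andP[DB].
case/conf_isoP => f0; rewrite CT => f0i' ED.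
have f0i : injective f0 by move=> x y; apply: f0i'.
rewrite sum1_card -(card_in_imset (f := fun s : {ffun S -> S} => [ffun x => f0 (s x)])) //=.
  apply: eq_card => f; rewrite -topredE /=; apply/andP/imsetP => [[/embP[fi' _] /eqP fD] | [s]].
    have fi : injective f by move=> x y; apply: fi'.
    (* Each [x] lies on a line of [C], whose image under [f] is also the image of a line under
       [f0]. *)
    have h x : f x \in codom f0.
      have : x \in cover C by rewrite CT inE.
      case/bigcupP => l lC xl; have : f @: l \in conf_image f0 C by rewrite -ED -fD imset_f.
      case/imsetP => l' l'C E; have : f x \in f0 @: l' by rewrite -E imset_f.
      by case/imsetP => y _ ->; rewrite codom_f.
    pose s := [ffun x => iinv (h x)]; have f0s x : f0 (s x) = f x by rewrite ffunE f_iinv.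
    exists s; last by apply/ffunP => x; rewrite ffunE f0s.
    rewrite inE; apply/andP; split.
      by apply/injectiveP => x y E; apply: fi; rewrite -!f0s E.
    apply/eqP/(imset_inj (imset_inj f0i)); rewrite -/(conf_image _ _) conf_image_comp.
    by rewrite -[RHS]ED -fD; apply: eq_conf_image.
  rewrite inE => /andP[/injectiveP si /eqP sC] ->.
  have E : conf_image [ffun x => f0 (s x)] C = D.
    rewrite ED -{2}sC conf_image_comp; apply: eq_conf_image => x; exact: ffunE.
  rewrite E eqxx; split=> //; apply/embP; split.
    by move=> x y _ _; rewrite !ffunE => /f0i/si.
  by move=> l lC; apply: (subsetP DB); rewrite -E imset_f.
move=> s t _ _ /ffunP E; apply/ffunP => x; apply: f0i.
by have := E x; rewrite !ffunE.
Qed.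

Lemma occurrences_expressible (S : finType) (C : {set {set S}}) :
  0 < #|C| <= 4 -> (forall l, l \in C -> #|l| = 3) ->
  expressible (fun T B => occurrences C B).
Proof.
case/andP => /card_gt0P[l0 l0C] C4 C3.
have /card_gt0P[x0 x0l] : 0 < #|l0| by rewrite C3.
have x0C : x0 \in cover C by apply/bigcupP; exists l0.
have [S' [C' [CC' C'C cT C'4 C'3]]] := spanning_copy x0C.
have [||e E] := @emb_expressible S' setT C'; first exact: leq_trans C4.
  by move=> l lC'; rewrite subsetT (C'3 3).
set n := #|[set s : {ffun S' -> S'} | injectiveb s & conf_image s C' == C']|.
exists (Bin Quot e (Lit n)) => T v B hB /=.
rewrite -E // card_emb_occurrences // -/n (occurrences_iso B CC' C'C) mulnK //.
(* The identity is an automorphism, so the divisor is positive. *)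
apply/card_gt0P; exists [ffun x => x]; rewrite inE; apply/andP; split.
  by apply/injectiveP => x y; rewrite !ffunE.
apply/eqP; rewrite -[RHS]imset_id; apply: eq_imset => l.
by rewrite -[RHS]imset_id; apply: eq_imset => x; rewrite ffunE.
Qed.

(** * Symbolic execution of machine programs *)

Definition reaches (P : program) (W n : nat) (s : state) (Q : state -> Prop) : Prop :=
  exists t, [/\ t <= n, Q (run P t s) & forall i, i <= t -> words_below W (run P i s)].

Definition env := seq (nat * nat).

Fixpoint get (e : env) (i : nat) : option nat :=
  if e is (d, x) :: e' then if i == d then Some x else get e' i else None.

Definition agrees (r : nat -> nat) (e : env) : Prop :=
  forall i x, get e i = Some x -> r i = x.

(** A Hoare triple with time and word bounds, in continuation style. The environment records only
    the registers whose contents matter, its newest entries shadowing older ones, while the memory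
    is known exactly. *)
Definition exec (P : program) (W n p : nat) (e : env) (m : nat -> nat)
    (Q : state -> Prop) : Prop :=
  forall r, agrees r e -> words_below W (State p r m) -> reaches P W n (State p r m) Q.

Definition assign (i : instr) (e : env) (m : nat -> nat) : option (nat * nat) :=
  let bin d a b (op : nat -> nat -> nat) :=
    if get e a is Some x then if get e b is Some y then Some (d, op x y) else None
    else None in
  match i with
  | Const d n => Some (d, n)
  | Move d a => if get e a is Some x then Some (d, x) else None
  | Add d a b => bin d a b addn
  | Defs.Sub d a b => bin d a b subn
  | Mul d a b => bin d a b muln
  | Div d a b => bin d a b divn
  | Read d a => if get e a is Some x then Some (d, m x) else None
  | _ => None
  end.

Section Exec.

Variables (P : program) (W : nat) (Q : state -> Prop).

Lemma reaches_step n s s' : step P s = Some s' -> words_below W s ->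
  reaches P W n s' Q -> reaches P W n.+1 s Q.
Proof.
move=> ss' Ws [t [tn Qt Wt]].
have runS i : run P i.+1 s = run P i s' by rewrite /run iterSr ss'.
by exists t.+1; split=> // [|[|i] // /Wt]; rewrite runS.
Qed.

Lemma exec_halt n p e m :
  (forall r, agrees r e -> Q (State p r m)) -> exec P W n p e m Q.
Proof. by move=> h r re Wr; exists 0; split=> // [|[|//] _]; first exact: h. Qed.

Lemma exec_leq n' n p e m : n' <= n -> exec P W n' p e m Q -> exec P W n p e m Q.
Proof.
move=> n'n h r re Wr; have [t [tn' ? ?]] := h r re Wr.
by exists t; split=> //; exact: leq_trans n'n.
Qed.

Lemma exec_weaken e' n p e m : (forall i x, get e' i = Some x -> get e i = Some x) ->
  exec P W n p e' m Q -> exec P W n p e m Q.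
Proof. by move=> ee' h r re; apply: h => i x /ee'/re. Qed.

(** A form of weakening checked by computation, used to drop shadowed and obsolete entries at the
    end of a block. *)
Lemma exec_sub e' n p e m : all (fun q => get e q.1 == Some q.2) e' ->
  exec P W n p e' m Q -> exec P W n p e m Q.
Proof.
move=> ee'; apply: exec_weaken => i x.
elim: e' ee' => //= -[d y] e' IH /andP[/eqP ey /IH]; case: eqP => [-> _ [<-] | ] //.
Qed.

Lemma exec_assign n p e m i d x : onth P p = Some i -> assign i e m = Some (d, x) ->
  x < W -> exec P W n p.+1 ((d, x) :: e) m Q -> exec P W n.+1 p e m Q.
Proof.
move=> Pi ai xW h r re Wr; apply: (@reaches_step _ _ (State p.+1 (upd r d x) m)) => //.
  rewrite /step Pi; case: i {Pi} ai => //=; try by move=> d' a b;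
    case Ea: get => [y|//]; case Eb: get => [z|//] [-> <-]; rewrite (re _ _ Ea) (re _ _ Eb).
  - by move=> d' n' [-> ->].
  - by move=> d' a; case E: get => [y|//] [-> <-]; rewrite (re _ _ E).
  - by move=> d' a; case E: get => [y|//] [-> <-]; rewrite (re _ _ E).
have [Wreg Wmem] := Wr; apply: h.
  by move=> j y /=; rewrite /upd; case: eqP => [_ [->] //|_]; exact: re.
by split=> //= j; rewrite /upd; case: eqP.
Qed.

Lemma exec_write n p e m a b x y : onth P p = Some (Write a b) ->
  get e a = Some x -> get e b = Some y ->
  exec P W n p.+1 e (upd m x y) Q -> exec P W n.+1 p e m Q.
Proof.
move=> Pi /[dup] ea Ea /[dup] eb Eb h r re Wr; have [Wreg Wmem] := Wr.
apply: (@reaches_step _ _ (State p.+1 r (upd m x y))) => //.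
  by rewrite /step Pi (re _ _ Ea) (re _ _ Eb).
(* The stored word comes from a register, hence is already below [W]. *)
apply: h => //; split=> //= j; rewrite /upd; case: eqP => // _.
by rewrite -(re _ _ Eb).
Qed.

Lemma exec_jump n p q e m : onth P p = Some (Jump q) ->
  exec P W n q e m Q -> exec P W n.+1 p e m Q.
Proof.
move=> Pi h r re Wr; apply: (@reaches_step _ _ (State q r m)) => //.
  by rewrite /step Pi.
exact: h.
Qed.

Lemma exec_jumplt n p q e m a b x y : onth P p = Some (JumpLt a b q) ->
  get e a = Some x -> get e b = Some y ->
  exec P W n (if x < y then q else p.+1) e m Q -> exec P W n.+1 p e m Q.
Proof.
move=> Pi Ea Eb h r re Wr.
apply: (@reaches_step _ _ (State (if x < y then q else p.+1) r m)) => //.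
  by rewrite /step Pi (re _ _ Ea) (re _ _ Eb).
exact: h.
Qed.

Lemma exec_jumpeq n p q e m a b x y : onth P p = Some (JumpEq a b q) ->
  get e a = Some x -> get e b = Some y ->
  exec P W n (if x == y then q else p.+1) e m Q -> exec P W n.+1 p e m Q.
Proof.
move=> Pi Ea Eb h r re Wr.
apply: (@reaches_step _ _ (State (if x == y then q else p.+1) r m)) => //.
  by rewrite /step Pi (re _ _ Ea) (re _ _ Eb).
exact: h.
Qed.

End Exec.

(** * Compilation of arithmetic expressions *)

Definition binop_instr (o : binop) : nat -> nat -> nat -> instr :=
  match o with Plus => Add | Minus => Defs.Sub | Times => Mul | Quot => Div end.

(* The order is read from register 1 and the number of Pasch triples from
   register 2; the registers from d on serve as an evaluation stack. *)
Fixpoint compile (e : aexp) (d : nat) : program :=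
  match e with
  | Lit n => [:: Const d n]
  | Order => [:: Move d 1]
  | Pasch => [:: Move d 2]
  | Bin o e1 e2 => compile e1 d ++ rcons (compile e2 d.+1) (binop_instr o d d d.+1)
  end.

Fixpoint word_exponent (e : aexp) : nat :=
  match e with
  | Lit n => n.+1
  | Order => 1
  | Pasch => 4
  | Bin _ e1 e2 => word_exponent e1 + word_exponent e2
  end.

Lemma word_exponent_gt0 e : 0 < word_exponent e.
Proof. by elim: e => //= _ e1 h1 e2 h2; rewrite addn_gt0 h1. Qed.

(** Both powers are at least 2, so their product exceeds the sum as well as the product of the two
    values; difference and quotient do not exceed the first value. Literals use [n < 2 ^ n.+1]. *)
Lemma aeval_bound e v p : p <= v ^ 3 -> aeval e v p < (v + 2) ^ word_exponent e.
Proof.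
move=> pv; have gt1 e' : 1 < (v + 2) ^ word_exponent e'.
  apply: leq_trans (leq_pexp2l (m := v + 2) (n1 := 1) _ _);
    rewrite ?expn1 ?word_exponent_gt0 //; lia.
elim: e => /= [n|||o e1 h1 e2 h2].
- apply: leq_trans (ltnW (ltn_expl n.+1 (ltnSn 1))) _; rewrite leq_exp2r //; lia.
- by rewrite expn1; lia.
- apply: leq_ltn_trans pv _; rewrite expnS.
  have : v ^ 3 <= (v + 2) ^ 3 by rewrite leq_exp2r; lia.
  have : 0 < (v + 2) ^ 3 by rewrite expn_gt0; lia.
  nia.
rewrite expnD; have := gt1 e1; have := gt1 e2.
case: o => /=; [nia | nia | nia |].
by have := leq_div (aeval e1 v p) (aeval e2 v p); nia.
Qed.

Lemma onth_size_cat (A : Type) (s1 s2 : seq A) (x : A) : onth (s1 ++ x :: s2) (size s1) = Some x.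
Proof. by rewrite onth_cat ltnn subnn. Qed.

(** The code has no jumps, so its running time is its length. As [E] is undefined from [d] on,
    partial results on the stack can be forgotten; [2 < d] protects registers 1 and 2. *)
Lemma exec_compile W Q v p m e pre post d n E : 2 < d ->
  p <= v ^ 3 -> (v + 2) ^ word_exponent e <= W ->
  get E 1 = Some v -> get E 2 = Some p -> (forall i, d <= i -> get E i = None) ->
  exec (pre ++ compile e d ++ post) W n (size pre + size (compile e d))
    ((d, aeval e v p) :: E) m Q ->
  exec (pre ++ compile e d ++ post) W (size (compile e d) + n) (size pre) E m Q.
Proof.
move=> + pv; elim: e => [k|||o e1 IH1 e2 IH2] in pre post d n E *;
  move=> d2 We E1 E2 Ed; have bd := aeval_bound _ pv.
- rewrite [compile _ _]/= [size [:: _]]/= add1n addn1 => h.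
  apply: (exec_assign (onth_size_cat pre post (Const d k)) (erefl _)) h.
  exact: leq_trans (bd _) We.
- rewrite [compile _ _]/= [size [:: _]]/= add1n addn1 => h.
  apply: (exec_assign (onth_size_cat pre post (Move d 1)) _ _ h); rewrite /= ?E1 //.
  exact: leq_trans (bd Order) We.
- rewrite [compile _ _]/= [size [:: _]]/= add1n addn1 => h.
  apply: (exec_assign (onth_size_cat pre post (Move d 2)) _ _ h); rewrite /= ?E2 //.
  exact: leq_trans (bd Pasch) We.
set c := compile (Bin o e1 e2) d => h; set ins := binop_instr o d d d.+1.
have W1 : (v + 2) ^ word_exponent e1 <= W.
  by apply: leq_trans We; apply: leq_pexp2l => /=; lia.
have W2 : (v + 2) ^ word_exponent e2 <= W.
  by apply: leq_trans We; apply: leq_pexp2l => /=; lia.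
have Ec1 : pre ++ c ++ post = pre ++ compile e1 d ++ (rcons (compile e2 d.+1) ins ++ post).
  by rewrite /c /= !catA.
have Ec2 : pre ++ c ++ post = (pre ++ compile e1 d) ++ compile e2 d.+1 ++ (ins :: post).
  by rewrite /c /= -cats1 -!catA.
have Ec3 : pre ++ c ++ post = ((pre ++ compile e1 d) ++ compile e2 d.+1) ++ ins :: post.
  by rewrite /c /= -cats1 -!catA.
have sc : size c = size (compile e1 d) + (size (compile e2 d.+1)).+1.
  by rewrite size_cat size_rcons.
rewrite Ec1 sc -addnA; apply: IH1 => //; rewrite -Ec1 Ec2 -size_cat addSnnS.
apply: IH2 => //.
- exact: leqW.
- by rewrite /= ltn_eqF //; lia.
- by rewrite /= ltn_eqF //; lia.
- by move=> i di /=; rewrite gtn_eqF // Ed // ltnW.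
rewrite -Ec2; apply: (exec_assign (i := ins) (d := d) (x := aeval (Bin o e1 e2) v p)).
- by rewrite Ec3 -size_cat onth_size_cat.
- by rewrite /ins; case: (o) => /=; rewrite eqxx ltn_eqF // eqxx.
- exact: leq_trans (bd _) We.
have -> : (size (pre ++ compile e1 d) + size (compile e2 d.+1)).+1 = size pre + size c.
  by rewrite sc size_cat; lia.
move: h; apply: exec_weaken => i x /=.
by case: (i == d) => //; case: eqP => // ->; rewrite Ed.
Qed.

(** * The program that counts Pasch triples *)

Definition address_code (a b : nat) : program := [:: Mul 9 a 1; Add 9 9 b; Add 9 9 2].
Definition store_code (a b c : nat) : program := rcons (address_code a b) (Write 9 c).
Definition load_code (d a b : nat) : program := rcons (address_code a b) (Read d 9).

(* Register 0 counts, 1 holds v, 2 the start of the table of third points (right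
   after the input), 3 the constant 1, 4 the loop variable, 9 a table address.
   The loop at 7 reads a line into registers 5, 6, 7 and stores its six table
   entries; in the loop at 43, whose bound v^3 is in register 5, the point triple
   in registers 6, 7, 8 is given by the base v digits of the loop variable. *)
Definition count_code : program :=
  [:: Const 3 1; Read 1 0; Read 2 3; Const 4 3; Mul 2 2 4; Const 4 2; Add 2 2 4;
      JumpLt 4 2 9; Jump 40;
      Read 5 4; Add 4 4 3; Read 6 4; Add 4 4 3; Read 7 4; Add 4 4 3] ++
  store_code 5 6 7 ++ store_code 6 5 7 ++ store_code 5 7 6 ++
  store_code 7 5 6 ++ store_code 6 7 5 ++ store_code 7 6 5 ++
  [:: Jump 7;
      Const 4 0; Mul 5 1 1; Mul 5 5 1;
      JumpLt 4 5 45; Jump 76;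
      Div 9 4 1; Mul 8 9 1; Defs.Sub 8 4 8; Div 6 9 1; Mul 7 6 1; Defs.Sub 7 9 7;
      JumpEq 6 7 74; JumpEq 6 8 74; JumpEq 7 8 74] ++
  load_code 10 6 7 ++ JumpEq 10 8 74 ::
  load_code 11 6 8 ++ load_code 12 7 8 ++ load_code 13 10 11 ++
  [:: JumpEq 13 12 73; Jump 74; Add 0 0 3; Add 4 4 3; Jump 43; Move 2 0].

(** * Correctness of the counting program *)

Lemma nth_flatten_triples (A : Type) (f g h : A -> nat) (s : seq A) j t :
  onth s j = Some t ->
  let u := flatten [seq [:: f t; g t; h t] | t <- s] in
  [/\ nth 0 u (3 * j) = f t, nth 0 u (3 * j).+1 = g t & nth 0 u (3 * j).+2 = h t].
Proof.
elim: s j => [|a s IH] [|j] // => [[->] // | /IH E].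
by have -> : 3 * j.+1 = (3 * j).+3 by lia.
Qed.

Section Count.

Variables (T : finType) (v : nat) (B : {set {set T}}).
Hypothesis hB : STS v B.
Variables (lab : T -> nat) (ts : seq (T * T * T)).
Hypothesis lab_inj : injective lab.
Hypothesis lab_lt : forall x, lab x < v.
Hypothesis ts_lines : perm_eq [seq [set t.1.1; t.1.2; t.2] | t <- ts] (enum B).

Let inp := v :: size ts :: flatten [seq [:: lab t.1.1; lab t.1.2; lab t.2] | t <- ts].
Let base := size ts * 3 + 2.

Variables (W : nat) (post : program) (Q : state -> Prop).
Hypothesis W_large : v ^ 3 + v * v + base + 3 < W.

Let P := count_code ++ post.

Definition addr (x y : T) := lab x * v + lab y + base.
Definition good (m : nat -> nat) (x y : T) := m (addr x y) = lab (third B x y).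

Lemma lab_onto i : i < v -> exists x, lab x = i.
Proof.
move=> iv; pose h x := Ordinal (lab_lt x).
have hi : injective h by move=> x y /(congr1 val) /= /lab_inj.
have [g _ gK] := inj_card_bij hi (eq_leq (esym (etrans (STS_card hB) (esym (card_ord v))))).
by exists (g (Ordinal iv)); have /(congr1 val) := gK (Ordinal iv).
Qed.

Lemma addr_inj x y x' y' : addr x y = addr x' y' -> x = x' /\ y = y'.
Proof.
move=> /addIn E; have vx := lab_lt y; have vy := lab_lt y'.
have v0 : 0 < v by exact: leq_ltn_trans vx.
have /lab_inj -> : lab x = lab x'.
  by have := congr1 (fun n => n %/ v) E; rewrite !divnMDl // !divn_small // !addn0.
have /lab_inj -> // : lab y = lab y'.
by have := congr1 (fun n => n %% v) E; rewrite !modnMDl !modn_small.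
Qed.

Lemma addr_lt x y : addr x y < W.
Proof.
have := lab_lt x; have := lab_lt y; rewrite /addr => ly lx.
have : (lab x).+1 * v <= v * v by rewrite leq_mul2r lx orbT.
by rewrite mulSn; lia.
Qed.

Lemma lab_ltW x : lab x < W.
Proof.
apply: ltn_trans (lab_lt x) _; have : v <= v * v by exact: leq_pmull (leq_ltn_trans _ (lab_lt x)).
by lia.
Qed.

(** Distinct pairs have distinct addresses, so storing a correct entry never spoils another one. *)
Lemma good_upd m x0 y0 x y : good m x y -> good (upd m (addr x0 y0) (lab (third B x0 y0))) x y.
Proof. by rewrite /good /upd; case: eqP => // /addr_inj[-> ->]. Qed.

Lemma good_upd_same m x y : good (upd m (addr x y) (lab (third B x y))) x y.
Proof. by rewrite /good /upd eqxx. Qed.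

(** Addressing code by position lets one lemma serve all copies of a store or load block. *)
Definition code_at (p : nat) (c : program) := forall i, i < size c -> onth P (p + i) = onth c i.

Lemma exec_address n p a b x y e m : code_at p (address_code a b) ->
  get e 1 = Some v -> get e 2 = Some base -> get e a = Some (lab x) ->
  get e b = Some (lab y) -> b != 9 ->
  exec P W n (p + 3) ((9, addr x y) :: e) m Q -> exec P W (n + 3) p e m Q.
Proof.
move=> Pp e1 e2 ea eb b9 h; rewrite addn3; have aW := addr_lt x y.
have P0 : onth P p = Some (Mul 9 a 1) by rewrite -[p]addn0 Pp.
have P1 : onth P p.+1 = Some (Add 9 9 b) by rewrite -addn1 Pp.
have P2 : onth P p.+2 = Some (Add 9 9 2) by rewrite -addn2 Pp.
apply: (exec_assign P0); first by rewrite /= ea e1.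
  by apply: leq_ltn_trans aW; rewrite /addr; lia.
apply: (exec_assign P1); first by rewrite /= (negPf b9) eb.
  by apply: leq_ltn_trans aW; rewrite /addr; lia.
apply: (exec_assign P2); first by rewrite /= e2.
  exact: aW.
by rewrite -addn3; apply: exec_weaken h => i z /=; case: eqP.
Qed.

(** The continuation sees the new memory only through three properties, so that successive stores do
    not pile up updates. *)
Lemma exec_store n p a b c x y e m : code_at p (store_code a b c) -> x != y ->
  get e 1 = Some v -> get e 2 = Some base -> get e a = Some (lab x) ->
  get e b = Some (lab y) -> get e c = Some (lab (third B x y)) -> b != 9 -> c != 9 ->
  get e 9 = None ->
  (forall m', (forall x' y', good m x' y' -> good m' x' y') -> good m' x y ->
     (forall i, i < base -> m' i = m i) -> exec P W n (p + 4) e m' Q) ->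
  exec P W (n + 4) p e m Q.
Proof.
move=> Pp xy e1 e2 ea eb ec b9 c9 e9 h; rewrite (addnS n 3) -addSn.
apply: (exec_address (a := a) (b := b) (x := x) (y := y)) => //.
  by case=> [|[|[|i]]] // _; rewrite Pp.
apply: (exec_write (a := 9) (b := c) (x := addr x y) (y := lab (third B x y))) => //.
- by rewrite (Pp 3).
- by rewrite /= (negPf c9).
rewrite -addnS; apply: (exec_weaken (e' := e)).
  by move=> i z /=; case: eqP => // ->; rewrite e9.
apply: h; first by move=> x' y'; exact: good_upd.
  exact: good_upd_same.
by move=> i ib; rewrite /upd /addr; case: eqP => // E; lia.
Qed.

Lemma exec_load n p d a b x y e m : code_at p (load_code d a b) -> x != y ->
  good m x y -> get e 1 = Some v -> get e 2 = Some base -> get e a = Some (lab x) ->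
  get e b = Some (lab y) -> b != 9 -> d != 9 ->
  get e 9 = None ->
  exec P W n (p + 4) ((d, lab (third B x y)) :: e) m Q -> exec P W (n + 4) p e m Q.
Proof.
move=> Pp xy mxy e1 e2 ea eb b9 d9 e9 h; rewrite (addnS n 3) -addSn.
apply: (exec_address (a := a) (b := b) (x := x) (y := y)) => //.
  by case=> [|[|[|i]]] // _; rewrite Pp.
apply: (exec_assign (i := Read d 9) (d := d) (x := lab (third B x y))).
- by rewrite (Pp 3).
- by rewrite /= mxy.
- exact: lab_ltW.
rewrite -addnS; apply: exec_weaken h => i z /=; case: (i == d) => //.
by case: eqP => // ->; rewrite e9.
Qed.

(** The first clause keeps the lines still to be read intact. Diagonal entries of the table are left
    unspecified. *)
Definition filled j m :=
  (forall i, i < base -> m i = nth 0 inp i) /\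
  forall t, t \in take j ts -> forall x y,
    x \in [:: t.1.1; t.1.2; t.2] -> y \in [:: t.1.1; t.1.2; t.2] -> x != y -> good m x y.

Definition fill_env j : env := [:: (0, 0); (1, v); (2, base); (3, 1); (4, 2 + 3 * j)].

(** The loop invariant is [filled j], with register 4 at the first point of line [j], past the two
    header words. A round costs the test, six instructions for reading, six stores of four and the
    jump back, 32 in all; leaving the loop costs 2. *)
Lemma exec_fill n k j m : j + k = size ts -> filled j m ->
  (forall m', filled (size ts) m' -> exec P W n 40 [:: (0, 0); (1, v); (2, base); (3, 1)] m' Q) ->
  exec P W (n + 2 + k * 32) 7 (fill_env j) m Q.
Proof.
move=> + + hn; elim: k j m => [|k IH] j m.
  rewrite addn0 => -> mj; rewrite mul0n addn0 addn2.
  apply: (exec_jumplt (a := 4) (b := 2)) => //.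
  have -> : (2 + 3 * size ts < base) = false by rewrite /base; lia.
  apply: (exec_jump (q := 40)) => //; apply: exec_sub (hn m mj).
  by rewrite /= !eqxx.
move=> jk [mlow mgood]; rewrite mulSn [32 + _]addnC addnA.
have jts : j < size ts by lia.
have [t tj] : exists t, onth ts j = Some t.
  by case E: (onth ts j) => [t|]; [exists t | move: (onthTE ts j); rewrite E jts].
have tB : [set t.1.1; t.1.2; t.2] \in B.
  rewrite -mem_enum -(perm_mem ts_lines); apply: (map_f (fun t => [set t.1.1; t.1.2; t.2])).
  by apply/onthP; exists j.
have [t12 t13 t23] := mem_line hB tB.
have := nth_flatten_triples (fun t => lab t.1.1) (fun t => lab t.1.2) (fun t => lab t.2) tj.
rewrite /=; set u := flatten _ => -[u1 u2 u3].
have mu i : i < 3 * size ts -> m (2 + i) = nth 0 u i.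
  by move=> ib; rewrite mlow // /base; lia.
have th : forall x y z, [set x; y; z] = [set t.1.1; t.1.2; t.2] -> x != y -> z = third B x y.
  by move=> x y z E xy; apply/eqP; rewrite -(thirdE hB) // E.
move: mgood mlow t12 t13 t23 th tB; set x := t.1.1; set y := t.1.2; set z := t.2.
move=> mgood mlow xy xz yz th tB.
have labW := lab_ltW.
have -> k' : k' + 32 = (k' + 1 + 4 + 4 + 4 + 4 + 4 + 4).+3.+4 by lia.
apply: (exec_jumplt (a := 4) (b := 2)) => //.
have -> : (2 + 3 * j < base) by rewrite /base; lia.
apply: (exec_assign (i := Read 5 4) (d := 5) (x := lab x)) => //.
  by rewrite /= mu ?u1 //; lia.
apply: (exec_assign (i := Add 4 4 3)) => //=; first by move: W_large; rewrite /base; lia.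
apply: (exec_assign (i := Read 6 4) (d := 6) (x := lab y)) => //.
  by rewrite /= addn1 -addnS mu ?u2 //; lia.
apply: (exec_assign (i := Add 4 4 3)) => //=; first by move: W_large; rewrite /base; lia.
apply: (exec_assign (i := Read 7 4) (d := 7) (x := lab z)) => //.
  by rewrite /= (_ : 2 + 3 * j + 1 + 1 = 2 + (3 * j).+2) ?mu ?u3 //; lia.
apply: (exec_assign (i := Add 4 4 3)) => //=; first by move: W_large; rewrite /base; lia.
apply: (exec_sub (e' := [:: (5, lab x); (6, lab y); (7, lab z); (0, 0); (1, v); (2, base);
    (3, 1); (4, 2 + 3 * j.+1)])).
  have -> : 2 + 3 * j.+1 = 2 + 3 * j + 1 + 1 + 1 by lia.
  by rewrite /= !eqxx.
set e := (X in exec _ _ _ _ X).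
have xyz : third B x y = z by rewrite -(th x y z).
have yxz : third B y x = z by rewrite -(thirdC hB).
have xzy : third B x z = y by rewrite -(th x z y) // setUAC.
have zxy : third B z x = y by rewrite -(thirdC hB).
have yzx : third B y z = x by rewrite -(th y z x) // setUC setUA.
have zyx : third B z y = x by rewrite -(thirdC hB).
apply: (exec_store (a := 5) (b := 6) (c := 7) (x := x) (y := y)); rewrite ?xyz //.
  by do 4?[case=> //].
move=> m1 g1 mxy l1.
apply: (exec_store (a := 6) (b := 5) (c := 7) (x := y) (y := x)); rewrite ?yxz 1?eq_sym //.
  by do 4?[case=> //].
move=> m2 g2 myx l2.
apply: (exec_store (a := 5) (b := 7) (c := 6) (x := x) (y := z)); rewrite ?xzy //.
  by do 4?[case=> //].
move=> m3 g3 mxz l3.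
apply: (exec_store (a := 7) (b := 5) (c := 6) (x := z) (y := x)); rewrite ?zxy 1?eq_sym //.
  by do 4?[case=> //].
move=> m4 g4 mzx l4.
apply: (exec_store (a := 6) (b := 7) (c := 5) (x := y) (y := z)); rewrite ?yzx //.
  by do 4?[case=> //].
move=> m5 g5 myz l5.
apply: (exec_store (a := 7) (b := 6) (c := 5) (x := z) (y := y)); rewrite ?zyx 1?eq_sym //.
  by do 4?[case=> //].
move=> m6 g6 mzy l6.
rewrite addn1; apply: (exec_jump (q := 7)) => //.
apply: (exec_sub (e' := fill_env j.+1)); first by rewrite /= !eqxx.
apply: IH; first by lia.
split=> [i ib|]; first by rewrite l6 // l5 // l4 // l3 // l2 // l1 // mlow.
move=> t'; rewrite (take_nth t) // mem_rcons in_cons (onth_nth t _ _ _ tj) => /orP[/eqP->|t'j] x' y'.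
  rewrite -/x -/y -/z !inE => /or3P[]/eqP-> /or3P[]/eqP->; rewrite ?eqxx // => _; auto 10.
by move=> x't y't xy'; apply/g6/g5/g4/g3/g2/g1; apply: mgood t'j _ _ _ _ _.
Qed.

Lemma filled_good m x y : filled (size ts) m -> x != y -> good m x y.
Proof.
case=> _ mgood xy; have : [set x; y; third B x y] \in B by exact: third_line hB _ _ xy.
rewrite -mem_enum -(perm_mem ts_lines) => /mapP[t tts E].
have mem w : w \in [set x; y; third B x y] -> w \in [:: t.1.1; t.1.2; t.2].
  by rewrite E !inE -!orbA.
by apply: (mgood t); rewrite ?take_size // mem // !inE eqxx ?orbT.
Qed.

(** The value of the loop variable at which [q] is examined. *)
Definition rank (q : T * T * T) := (lab q.1.1 * v + lab q.1.2) * v + lab q.2.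

Definition pasch_below N := #|[set q | pasch_triple B q.1.1 q.1.2 q.2 & rank q < N]|.

(** Remainders appear as differences because the machine has no remainder instruction. *)
Lemma rank_digits q : let N := rank q in
  [/\ N %/ v %/ v = lab q.1.1, N %/ v - lab q.1.1 * v = lab q.1.2
    & N - N %/ v * v = lab q.2].
Proof.
have [v1 v2] := (lab_lt q.1.2, lab_lt q.2); have v0 : 0 < v by exact: leq_ltn_trans v1.
have E : rank q %/ v = lab q.1.1 * v + lab q.1.2.
  by rewrite /rank divnMDl // divn_small // addn0.
by split; rewrite E ?addKn // divnMDl // divn_small // addn0.
Qed.

Lemma rank_inj : injective rank.
Proof.
move=> q q' E; have [a1 a2 a3] := rank_digits q; have [b1 b2 b3] := rank_digits q'.
rewrite {}E in a1 a2 a3.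
have e1 : q.1.1 = q'.1.1 by apply: lab_inj; rewrite -a1.
have e2 : q.1.2 = q'.1.2 by apply: lab_inj; rewrite -a2 e1.
have e3 : q.2 = q'.2 by apply: lab_inj; rewrite -a3.
by move: e1 e2 e3; case: q q' {a1 a2 a3 b1 b2 b3} => [[x y] z] [[x' y'] z'] /= -> -> ->.
Qed.

Lemma rank_onto N : N < v ^ 3 -> exists q, rank q = N.
Proof.
move=> Nv; have v0 : 0 < v by case: v Nv => //; rewrite exp0n.
have [z Ez] := lab_onto (ltn_pmod N v0).
have [y Ey] := lab_onto (ltn_pmod (N %/ v) v0).
have [x Ex] : exists x, lab x = N %/ v %/ v.
  by apply: lab_onto; rewrite !ltn_divLR // -mulnA mulnn -expnS.
by exists (x, y, z); rewrite /rank /= Ex Ey Ez -!divn_eq.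
Qed.

Lemma rank_lt q : rank q < v ^ 3.
Proof.
rewrite /rank; have := lab_lt q.1.1; have := lab_lt q.1.2; have := lab_lt q.2.
move: (lab q.1.1) (lab q.1.2) (lab q.2) => a b c cv bv av.
have h1 : a * v + b < v * v.
  by have : a.+1 * v <= v * v; [rewrite leq_mul2r av orbT | rewrite mulSn; lia].
have : (a * v + b).+1 * v <= v * v * v by rewrite leq_mul2r h1 orbT.
by rewrite mulSn !expnS expn0 muln1 mulnA; lia.
Qed.

Lemma pasch_belowS q :
  pasch_below (rank q).+1 = pasch_below (rank q) + pasch_triple B q.1.1 q.1.2 q.2.
Proof.
rewrite /pasch_below; set X := [set _ | _ & _ < rank q].
have ltE q' : (rank q' < (rank q).+1) = (q' == q) || (rank q' < rank q).
  by rewrite ltnS leq_eqVlt (inj_eq rank_inj).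
case: (boolP (pasch_triple _ _ _ _)) => pt /=; last first.
  rewrite addn0; apply: eq_card => q'; rewrite !inE ltE.
  by case: eqP => // ->; rewrite (negPf pt).
have qX : q \notin X by rewrite inE ltnn andbF.
transitivity #|q |: X|; last by rewrite cardsU1 qX addnC.
apply: eq_card => q'; rewrite !inE ltE.
by case: eqP => // ->; rewrite pt.
Qed.

Lemma pasch_below_all : pasch_below (v ^ 3) = pasch B.
Proof. by apply: eq_card => q; rewrite !inE rank_lt andbT. Qed.

Lemma pasch_below_leq N : pasch_below N <= v ^ 3.
Proof.
apply: leq_trans (pasch_leq hB); apply/subset_leq_card/subsetP => q.
by rewrite !inE => /andP[].
Qed.

Definition count_env N : env :=
  [:: (0, pasch_below N); (1, v); (2, base); (3, 1); (4, N); (5, v ^ 3)].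

(** Register 0 holds [pasch_below N] throughout, and memory is only read. The 40 steps allowed per
    round are an upper bound; early exits are absorbed by [exec_leq]. *)
Lemma exec_count n k N m : N + k = v ^ 3 -> (forall x y, x != y -> good m x y) ->
  exec P W n 77 [:: (1, v); (2, pasch B)] m Q ->
  exec P W (n + 3 + k * 40) 43 (count_env N) m Q.
Proof.
move=> + mgood hn; elim: k N => [|k IH] N.
  rewrite addn0 => ->; rewrite mul0n addn0 addn3.
  apply: (exec_jumplt (a := 4) (b := 5)) => //; rewrite ltnn.
  apply: (exec_jump (q := 76)) => //.
  apply: (exec_assign (i := Move 2 0)) => //=.
    by apply: leq_ltn_trans (pasch_below_leq _) _; lia.
  by apply: exec_sub hn; rewrite pasch_below_all /= !eqxx.
move=> Nk; rewrite mulSn [40 + _]addnC addnA; set n' := n + 3 + k * 40.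
have [q Eq] : exists q, rank q = N by apply: rank_onto; lia.
have [dx dy dz] := rank_digits q; rewrite Eq in dx dy dz.
have pS := pasch_belowS q; rewrite Eq in pS.
case: q {Eq} => [[x y] z] /= in dx dy dz pS *.
have NW : N < W by lia.
(* The tail shared by all outcomes of a round, entered once register 0 is up to date. *)
have finish e : get e 0 = Some (pasch_below N.+1) -> get e 1 = Some v ->
    get e 2 = Some base -> get e 3 = Some 1 -> get e 4 = Some N -> get e 5 = Some (v ^ 3) ->
    exec P W n'.+2 74 e m Q.
  move=> e0 e1 e2 e3 e4 e5.
  apply: (exec_assign (i := Add 4 4 3) (d := 4) (x := N.+1)) => //=.
  - by rewrite e4 e3 addn1.
  - by lia.
  apply: (exec_jump (q := 43)) => //; apply: (exec_sub (e' := count_env N.+1)).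
    by rewrite /= e0 e1 e2 e3 e5 !eqxx.
  by apply: IH; lia.
have labW := lab_ltW.
have -> : n' + 40 = ((n' + 13 + 4 + 4 + 4).+1 + 4).+3.+4.+3 by lia.
apply: (exec_jumplt (a := 4) (b := 5)) => //.
have -> : N < v ^ 3 by lia.
apply: (exec_assign (i := Div 9 4 1)) => //=; first by apply: leq_ltn_trans (leq_div _ _) _.
apply: (exec_assign (i := Mul 8 9 1)) => //=.
  by apply: leq_ltn_trans (leq_divM _ _) _.
apply: (exec_assign (i := Defs.Sub 8 4 8)) => //=; first by rewrite dz.
apply: (exec_assign (i := Div 6 9 1)) => //=; first by rewrite dx.
apply: (exec_assign (i := Mul 7 6 1)) => //=.
  apply: leq_ltn_trans (leq_divM _ _) _.
  by apply: leq_ltn_trans (leq_div _ _) _.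
apply: (exec_assign (i := Defs.Sub 7 9 7)) => //=; first by rewrite dx dy.
rewrite dx dy dz.
apply: (exec_sub (e' := [:: (6, lab x), (7, lab y), (8, lab z) & count_env N])).
  by rewrite /= !eqxx.
set e := (X in exec _ _ _ _ X).
apply: (exec_jumpeq (a := 6) (b := 7)) => //; rewrite (inj_eq lab_inj); case: ifPn => xy.
  apply: (exec_leq (n' := n'.+2)); first by lia.
  by apply: finish => //; rewrite pS /pasch_triple xy addn0.
apply: (exec_jumpeq (a := 6) (b := 8)) => //; rewrite (inj_eq lab_inj); case: ifPn => xz.
  apply: (exec_leq (n' := n'.+2)); first by lia.
  by apply: finish => //; rewrite pS /pasch_triple xz andbF addn0.
apply: (exec_jumpeq (a := 7) (b := 8)) => //; rewrite (inj_eq lab_inj); case: ifPn => yz.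
  apply: (exec_leq (n' := n'.+2)); first by lia.
  by apply: finish => //; rewrite pS /pasch_triple yz !andbF addn0.
(* The last table lookup needs distinct points, since diagonal entries are not filled. *)
have wu : third B x y != third B x z by apply: contra_neq yz; apply: (third_inj hB).
apply: (exec_load (d := 10) (a := 6) (b := 7) (x := x) (y := y)) => //.
- by do 4?[case=> //].
- exact: mgood.
apply: (exec_jumpeq (a := 10) (b := 8)) => //; rewrite (inj_eq lab_inj); case: ifPn => wz.
  apply: (exec_leq (n' := n'.+2)); first by lia.
  by apply: finish => //; rewrite pS /pasch_triple wz !andbF addn0.
apply: (exec_load (d := 11) (a := 6) (b := 8) (x := x) (y := z)) => //.
- by do 4?[case=> //].
- exact: mgood.
apply: (exec_load (d := 12) (a := 7) (b := 8) (x := y) (y := z)) => //.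
- by do 4?[case=> //].
- exact: mgood.
apply: (exec_load (d := 13) (a := 10) (b := 11) (x := third B x y) (y := third B x z)) => //.
- by do 4?[case=> //].
- exact: mgood.
apply: (exec_leq (n' := n'.+4)); first by lia.
apply: (exec_jumpeq (a := 13) (b := 12)) => //; rewrite (inj_eq lab_inj).
rewrite /pasch_triple xy xz yz wz /= in pS; case: ifPn => t4.
- rewrite t4 in pS; apply: (exec_assign (i := Add 0 0 3)) => //=.
    by rewrite -pS; apply: leq_ltn_trans (pasch_below_leq _) _; lia.
  by apply: finish => //=; rewrite pS.
- rewrite (negPf t4) addn0 in pS.
  by apply: (exec_jump (q := 74)) => //; apply: finish; rewrite //= pS.
Qed.

Lemma exec_count_code n :
  (forall m, exec P W n 77 [:: (1, v); (2, pasch B)] m Q) ->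
  exec P W (n + 15 + v ^ 3 * 40 + size ts * 32) 0 [:: (0, 0)] (nth 0 inp) Q.
Proof.
move=> hn; have sW : size ts * 3 < W by move: W_large; rewrite /base; lia.
have vW : v < W by move: W_large; case: v => // v'; nia.
have -> : n + 15 + v ^ 3 * 40 + size ts * 32 =
  ((n + 3 + v ^ 3 * 40).+3 + 2 + size ts * 32).+4.+3 by lia.
apply: (exec_assign (i := Const 3 1)) => //=; first by lia.
(* Registers 0 and 3 hold 0 and 1, so they serve as addresses of the two header words. The later
   [Const 4 2] also leaves register 4 at the first line. *)
apply: (exec_assign (i := Read 1 0)) => //=.
apply: (exec_assign (i := Read 2 3)) => //=; first by lia.
apply: (exec_assign (i := Const 4 3)) => //=; first by lia.
apply: (exec_assign (i := Mul 2 2 4)) => //=.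
apply: (exec_assign (i := Const 4 2)) => //=; first by lia.
apply: (exec_assign (i := Add 2 2 4)) => //=; first by lia.
apply: (exec_sub (e' := fill_env 0)); first by rewrite /= !eqxx.
apply: exec_fill => // [|m fm]; first by split=> // t; rewrite take0.
apply: (exec_assign (i := Const 4 0)) => //=; first by lia.
apply: (exec_assign (i := Mul 5 1 1)) => //=; first by lia.
apply: (exec_assign (i := Mul 5 5 1) (d := 5) (x := v ^ 3)) => //=.
- by rewrite !expnS expn0 muln1 mulnA.
- by lia.
apply: (exec_sub (e' := count_env 0)).
  rewrite /= !eqxx !andbT; apply/eqP; congr Some.
  by apply/esym/eq_card0 => q; rewrite inE ltn0 andbF.
by apply: exec_count => // x y; apply: filled_good.
Qed.

End Count.

Theorem theorem3 (S : finType) (w : nat) (A C : {set {set S}})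
    (hA : STS w A) (hCA : C \subset A) (hC4 : #|C| = 4)
    (hvar : variable_conf C) :
  sts_computable_in_time (fun (T : finType) (B : {set {set T}}) => occurrences C B)
                         (fun v => v ^ 3).
Proof.
have [||e eE] := @occurrences_expressible _ C; first by rewrite hC4.
  by move=> l /(subsetP hCA); case: hA => _ + _; apply.
(* The evaluation stack starts at register 3, above the two arguments; the last move brings the
   value to the output register. *)
pose tail := compile e 3 ++ [:: Move 0 3].
pose P := count_code ++ tail.
(* The time is at most [size (compile e 3) + 16 + 40 * v ^ 3 + 32 * size ts] with
   [size ts <= v ^ 3], and [1 <= v] lets [v ^ 3] absorb the constants. The exponent covers both the
   values of [e] and the addresses and counters, which stay below [(v + 2) ^ 5]. *)
exists P, (size (compile e 3) + 88), 1, (word_exponent e + 5).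
move=> v T B inp hB [lab [ts [lab_inj lab_lt ts_lines inpE]]].
rewrite (STS_card hB) in lab_lt inpE.
set W := (v + 2) ^ _.
have sts : size ts <= v ^ 2.
  apply: leq_trans (card_lines hB).
  by rewrite cardE -(perm_size ts_lines) size_map.
have We : (v + 2) ^ word_exponent e <= W by apply: leq_pexp2l; lia.
have W5 : (v + 2) ^ 5 <= W by apply: leq_pexp2l; lia.
have WL : v ^ 3 + v * v + (size ts * 3 + 2) + 3 < W.
  apply: leq_trans W5; move: sts; rewrite !expnS !expn0 !muln1; nia.
pose Q s := step P s = None /\ output s = occurrences C B.
have hn m : exec P W (size (compile e 3) + 1) 77 [:: (1, v); (2, pasch B)] m Q.
  apply: (exec_compile (pre := count_code) _ (pasch_leq hB) We) => //.
    by case=> [|[|[|]]].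
  have Pe : onth P (77 + size (compile e 3)) = Some (Move 0 3).
    by rewrite /P /tail catA onth_cat size_cat ltnn subnn.
  apply: (exec_assign (i := Move 0 3)); [exact: Pe | by [] | |].
    exact: leq_trans (aeval_bound e (pasch_leq hB)) We.
  apply: exec_halt => r re; split; last by rewrite /output /= (re 0 _ erefl) -eE.
  (* The machine halts by running past the last instruction. *)
  by rewrite /step onth_default // /P /tail !size_cat /= addn1 addnS.
have inW : words_below W (init_state inp).
  split=> /= [_|i]; first by lia.
  have [inpi|inpi] := ltnP i (size inp); last by rewrite nth_default //; lia.
  have vW : v < W by apply: leq_trans W5; rewrite !expnS expn0; nia.
  have := mem_nth 0 inpi; rewrite {2}inpE !inE => /or3P[/eqP->|/eqP->|] //; first by lia.
  case/flattenP => _ /mapP[t _ ->]; rewrite !inE => /or3P[]/eqP->;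
    exact: ltn_trans (lab_lt _) vW.
have ini : agrees (fun=> 0) [:: (0, 0)] by move=> i x /=; case: eqP => // _ [].
have := exec_count_code hB lab_inj lab_lt ts_lines WL hn.
rewrite -inpE => /(_ _ ini inW)[t [tn [Qstop Qout] Wt]].
exists t; split=> // v1; apply: leq_trans tn _.
have : size ts <= v ^ 3 by apply: leq_trans sts _; rewrite leq_pexp2l.
have : 0 < v ^ 3 by rewrite expn_gt0 v1.
nia.
Qed.
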